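(* The relation of homomorphism (respectively, of weak-homomorphism) on the class $OCT$ of countable ordered combinatorial trees is a complete analytic quasi-order. Moreover, if $R$ is an analytic quasi-order on a standard Borel space $X$, then there is an $\mathcal{L}_{\omega_1\omega}$-sentence $\varphi$, where $\mathcal{L}=\{P,Q\}$ consists of two binary relation symbols, such that $R$ is Borel equivalent to the relation of homomorphism (respectively, weak-homomorphism) on $Mod_\varphi$.
   Context: For $\mathcal{L}$-structures $G,G'$ ($\mathcal{L}=\{P,Q\}$, two binary relation symbols), $G$ is homomorphic to $G'$ if there is a function $h$ from the domain of $G$ to that of $G'$ (not necessarily injective) with $g_0P^Gg_1\iff h(g_0)P^{G'}h(g_1)$ and $g_0Q^Gg_1\iff h(g_0)Q^{G'}h(g_1)$ for all $g_0,g_1$; $G$ is weakly-homomorphic to $G'$ if there is $h$ with $g_0P^Gg_1\Rightarrow h(g_0)P^{G'}h(g_1)$ and $g_0Q^Gg_1\Rightarrow h(g_0)Q^{G'}h(g_1)$. An ordered combinatorial tree is an $\mathcal{L}$-structure in which $P$ is a combinatorial tree (connected, acyclic graph) and $Q$ is a transitive relation; $OCT$ is the Borel set of such structures with universe $\omega$. Complete analytic quasi-order: an analytic quasi-order to which every analytic quasi-order on a standard Borel space is Borel reducible. $Mod_\varphi$ is the standard Borel space of $\mathcal{L}$-structures with universe $\omega$ satisfying $\varphi$. Borel reducibility $R\le_B R'$: there is a Borel $f$ with $xRy\iff f(x)R'f(y)$; Borel equivalent means reducible both ways. *)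

(* Defs.v *)
From HB Require Import structures.
From mathcomp Require Import all_boot all_order all_algebra.
From mathcomp Require Import all_classical all_reals all_analysis.

Set Implicit Arguments.
Unset Strict Implicit.
Unset Printing Implicit Defensive.

Local Open Scope classical_set_scope.

Definition polish (K : realType) (Y : metricType K) : Prop :=
  (forall F : set_system Y, ProperFilter F -> cauchy F ->
     exists y : Y, F --> y) /\
  exists2 D : set Y, countable D & dense D.

(* f is an isomorphism of X with the Borel space of a Polish space. *)
Definition standard_borel (K : realType) d (X : measurableType d) : Prop :=
  exists (Y : metricType K) (f : X -> Y),
    [/\ polish Y, bijective f &
        forall B : set Y, measurable (f @^-1` B) <-> <<s (@open Y) >> B].

(* A measurableType is pointed, so it cannot be the empty standard Borel space.
   Hence standard Borel spaces are presented below as Borel subsets A (possibly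
   set0 or setT) of a standard Borel measurableType, with the induced
   sigma-algebra, and relations are only considered on A. *)

Definition analytic (K : realType) d (X : measurableType d) (C : set X) : Prop :=
  exists d' (Y : measurableType d') (B : set Y) (f : Y -> X),
    [/\ standard_borel K Y, measurable B, measurable_fun B f & C = f @` B].

Definition quasi_order_on (X : Type) (A : set X) (R : X -> X -> Prop) : Prop :=
  (forall x, A x -> R x x) /\
  (forall x y z, A x -> A y -> A z -> R x y -> R y z -> R x z).

Definition analytic_quasi_order (K : realType) d (X : measurableType d)
    (A : set X) (R : X -> X -> Prop) : Prop :=
  [/\ standard_borel K X, measurable A, quasi_order_on A R &
      analytic K [set p : X * X | [/\ A p.1, A p.2 & R p.1 p.2]]].

Definition borel_reducible d (X : measurableType d) (A : set X)
    (R : X -> X -> Prop) d' (Y : measurableType d') (B : set Y)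
    (S : Y -> Y -> Prop) : Prop :=
  exists f : X -> Y,
    [/\ measurable_fun A f, (forall x, A x -> B (f x)) &
        forall x y, A x -> A y -> (R x y <-> S (f x) (f y))].

Definition borel_equivalent d (X : measurableType d) (A : set X)
    (R : X -> X -> Prop) d' (Y : measurableType d') (B : set Y)
    (S : Y -> Y -> Prop) : Prop :=
  borel_reducible A R B S /\ borel_reducible B S A R.

Definition complete_analytic_quasi_order (K : realType) d
    (Y : measurableType d) (B : set Y) (S : Y -> Y -> Prop) : Prop :=
  analytic_quasi_order K B S /\
  forall d' (X : measurableType d') (A : set X) (R : X -> X -> Prop),
    analytic_quasi_order K A R -> borel_reducible A R B S.

Variant symbol := symP | symQ.

Definition structure (M : Type) := symbol -> M -> M -> bool.

Definition homomorphic (M N : Type) (G : structure M) (H : structure N) : Prop :=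
  exists h : M -> N, forall s x y, G s x y <-> H s (h x) (h y).

Definition weakly_homomorphic (M N : Type) (G : structure M)
    (H : structure N) : Prop :=
  exists h : M -> N, forall s x y, G s x y -> H s (h x) (h y).

HB.instance Definition _ :=
  Pointed.copy (structure nat) (symbol -> nat -> nat -> bool).

(* Together with their complements, a subbase of 2^(omega^2) x 2^(omega^2); this
   space being second countable, they generate its Borel sets. *)
Definition cylinders : set (set (structure nat)) :=
  [set C | exists s i j, C = [set G : structure nat | G s i j]].

Definition omega_structure := g_sigma_algebraType cylinders.

Definition combinatorial_tree (e : rel nat) : Prop :=
  [/\ irreflexive e, symmetric e,
      (forall x y, exists2 p, path e x p & last x p = y) &
      forall c : seq nat, (2 < size c)%N -> ~ ucycle e c].

Definition OCT : set omega_structure :=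
  [set G | combinatorial_tree (G symP) /\ transitive (G symQ)].

(* L_{omega_1 omega}; variables are named by natural numbers. *)
Inductive formula :=
| Rel of symbol & nat & nat
| Equal of nat & nat
| Not of formula
| And of (nat -> formula)
| Or of (nat -> formula)
| All of nat & formula
| Ex of nat & formula.

Definition update (M : Type) (v : nat -> M) (i : nat) (a : M) : nat -> M :=
  fun j => if j == i then a else v j.

Fixpoint sat (M : Type) (G : structure M) (phi : formula) (v : nat -> M) : Prop :=
  match phi with
  | Rel s i j => G s (v i) (v j)
  | Equal i j => v i = v j
  | Not psi => ~ sat G psi v
  | And psi => forall n, sat G (psi n) v
  | Or psi => exists n, sat G (psi n) v
  | All i psi => forall a, sat G psi (update v i a)
  | Ex i psi => exists a, sat G psi (update v i a)
  end.

Fixpoint free_vars (phi : formula) : set nat :=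
  match phi with
  | Rel _ i j | Equal i j => [set i; j]
  | Not psi => free_vars psi
  | And psi | Or psi => \bigcup_n free_vars (psi n)
  | All i psi | Ex i psi => free_vars psi `\ i
  end.

(* In a sentence every subformula has finitely many free variables, as each of
   them is bound by one of the finitely many quantifiers above it; so the usual
   finiteness condition on the formulas of L_{omega_1 omega} is automatic. *)
Definition sentence (phi : formula) : Prop := free_vars phi = set0.

Definition Mod (phi : formula) : set omega_structure :=
  [set G | forall v : nat -> nat, sat G phi v].

Lemma sat_free (M : Type) (G : structure M) (phi : formula) (v w : nat -> M) :
  (forall i, free_vars phi i -> v i = w i) -> sat G phi v <-> sat G phi w.
Proof.
elim: phi v w => /= [s i j|i j|psi IH|psi IH|psi IH|i psi IH|i psi IH] v w vw.
- by rewrite (vw i) ?(vw j); [|right|left].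
- by rewrite (vw i) ?(vw j); [|right|left].
- by have := IH _ _ vw; tauto.
- by split=> h n; apply/(IH n v w) => // i ?; apply: vw; exists n.
- by split=> -[n h]; exists n; apply/(IH n v w) => // i ?; apply: vw; exists n.
- have e a j : free_vars psi j -> update v i a j = update w i a j.
    by rewrite /update; case: eqP => // ij fj; apply: vw.
  by split=> h a; apply/(IH _ _ (e a)).
- have e a j : free_vars psi j -> update v i a j = update w i a j.
    by rewrite /update; case: eqP => // ij fj; apply: vw.
  by split=> -[a h]; exists a; apply/(IH _ _ (e a)).
Qed.

Lemma measurable_sat (phi : formula) (v : nat -> nat) :
  measurable [set G : omega_structure | sat G phi v].
Proof.
elim: phi v => /= [s i j|i j|psi IH|psi IH|psi IH|i psi IH|i psi IH] v.
- by apply: sub_sigma_algebra; exists s, (v i), (v j).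
- have [e|e] := pselect (v i = v j).
    by rewrite (_ : mkset _ = setT) //; apply/seteqP; split.
  by rewrite (_ : mkset _ = set0) //; apply/seteqP; split.
- exact: (measurableC (IH v)).
- rewrite (_ : mkset _ = \bigcap_n [set G | sat G (psi n) v]).
    exact: bigcap_measurable.
  by apply/seteqP; split=> G h n; [move=> _|]; exact: h.
- rewrite (_ : mkset _ = \bigcup_n [set G | sat G (psi n) v]).
    exact: bigcup_measurable.
  by apply/seteqP; split=> G [n h]; [exists n|case: h => h; exists n].
- rewrite (_ : mkset _ = \bigcap_a [set G | sat G psi (update v i a)]).
    exact: bigcap_measurable.
  by apply/seteqP; split=> G h n; [move=> _|]; exact: h.
- rewrite (_ : mkset _ = \bigcup_a [set G | sat G psi (update v i a)]).
    exact: bigcup_measurable.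
  by apply/seteqP; split=> G [n h]; [exists n|case: h => h; exists n].
Qed.

(* So measurable_fun (Mod phi) f, which presupposes that its domain is
   measurable, is not vacuous for sentences. *)
Lemma measurable_Mod (phi : formula) : sentence phi -> measurable (Mod phi).
Proof.
move=> s; rewrite (_ : Mod phi = [set G | sat G phi id]).
  exact: measurable_sat.
apply/seteqP; split=> G h; first exact: h.
by move=> v; apply/(sat_free G (w := id)) => // i; rewrite s.
Qed.

(* Main.v *)
(* An analytic relation on 2^w is the projection of a closed subset of
   2^w x 2^w x w^w.  If it is transitive, then, up to equality, x R y holds iff
   there is an infinite branch of approximations to a chain
   x = w_0, w_1, ..., w_m = y of pairs in the closed set.  Let s range over the
   finite approximations of the inner part of such a chain (the points w_i and
   the witnesses), and attach to s the labels u of length |s| such that s links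
   u to y; call the resulting labelled tree T_y.  If x R y, appending x and a
   witness to every s maps T_x into T_y and preserves labels; conversely, a
   label-preserving tree map sends the branch of empty chains from x to x to a
   branch witnessing that x = y or x R y.

   Labels and levels are coded by an ordered combinatorial tree: P is the
   edge relation, Q is the tree order together with loops at the root and at
   some leaves, and the label u of s becomes a looped leaf at the end of a
   path starting at s, at a level that determines u.  All the nodes and leaves
   are the same for all y, and only the loops depend on y.

   Finally, the number of leaves of a node depends injectively on the node.  It
   is invisible to homomorphisms, which may identify leaves of the same node,
   but it makes every node definable, and hence lets a sentence of
   L_{omega_1 omega} pin down the structures up to homomorphisms both ways. *)
From HB Require Import structures.
Require Import Defs.
From mathcomp Require Import all_boot all_order all_algebra.
From mathcomp Require Import all_classical all_reals all_analysis.
From mathcomp Require Import zify lra.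

Set Implicit Arguments.
Unset Strict Implicit.
Unset Printing Implicit Defensive.
Import Order.TTheory GRing.Theory Num.Theory.
Local Open Scope classical_set_scope.

(** * Marked trees *)

Section MarkedTree.
Variable L : countType.
Implicit Types (a b : seq L) (x y : seq L * nat) (M : pred (seq L)).

(** Injective in [a], so that a node can be told by the number of its leaves, and at least 2, so
    that every node has a leaf that may carry a loop and a leaf that never does. *)
Definition leaf_count a := (pickle a).+2.

(* (a, 0) is the node a and (a, i.+1) is its i-th leaf; among the leaves of a
   only (a, 1) can carry a loop, and it does iff M a. *)
Definition vertex := {x : seq L * nat | x.2 <= leaf_count x.1}.

Definition anc x y := [&& x.2 == 0, prefix x.1 y.1 & x != y].

Definition rank x := size x.1 + (x.2 != 0).

Definition par x y := anc x y && (rank y == (rank x).+1).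

(** The root is the only node with a loop, so a map that preserves loops and sends nodes to nodes
    fixes the root. *)
Definition mark M x := (x == ([::], 0)) || (x.2 == 1) && M x.1.

Definition raw_tree M : structure (seq L * nat) := fun s x y =>
  match s with
  | symP => par x y || par y x
  | symQ => anc x y || (x == y) && mark M x
  end.

Definition marked_tree M : structure vertex :=
  fun s u v => raw_tree M s (val u) (val v).

Definition node a : vertex := exist _ (a, 0) isT.

Lemma leaf_subproof a i : i <= 1 -> i.+1 <= leaf_count a.
Proof. by case: i => [|[]]. Qed.

Definition leaf1 a : vertex := exist _ (a, 1) (leaf_subproof a (leq0n 1)).
Definition leaf2 a : vertex := exist _ (a, 2) (leaf_subproof a (leqnn 1)).

Lemma ancxx x : anc x x = false.
Proof. by rewrite /anc eqxx !andbF. Qed.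

Lemma anc_rank x y : anc x y -> rank x < rank y.
Proof.
case: x y => [a i] [b j] /and3P[/= /eqP -> pab]; rewrite /rank /= addn0 => ne.
have := size_prefix pab; rewrite leq_eqVlt => /orP[/eqP e|ab]; last first.
  exact: leq_trans ab (leq_addr _ _).
have ab : a = b by apply/eqP; move: pab; rewrite prefixE e take_size eq_sym.
by move: ne; rewrite ab; case: j => [|j _]; [rewrite eqxx|rewrite /= addn1].
Qed.

Lemma anc_trans x y z : anc x y -> anc y z -> anc x z.
Proof.
move=> xy yz; have := ltn_trans (anc_rank xy) (anc_rank yz).
move: xy yz => /and3P[x2 pxy _] /and3P[_ pyz _] r.
rewrite /anc x2 (prefix_trans pxy pyz) /=.
by apply: contraTneq r => ->; rewrite ltnn.
Qed.


Lemma par_fst0 x y : par x y -> x.2 = 0.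
Proof. by move=> /andP[/and3P[/eqP]]. Qed.

Lemma par_rcons a l : par (a, 0) (rcons a l, 0).
Proof.
rewrite /par /anc /rank /= !addn0 size_rcons eqxx andbT -cats1 prefix_prefix.
rewrite /= xpair_eqE andbT; apply/eqP => /(congr1 size).
by rewrite size_cat addn1 => /eqP; rewrite -[X in X == _]addn0 -addn1 eqn_add2l.
Qed.

Lemma par_leaf a i : par (a, 0) (a, i.+1).
Proof.
by rewrite /par /anc /rank /= addn0 addn1 eqxx prefix_refl xpair_eqE andbF.
Qed.

Lemma par_nodeP a b : par (a, 0) (b, 0) -> exists l, b = rcons a l.
Proof.
move=> /andP[/and3P[_ /= /prefixP[c ->] _]].
rewrite /rank /= !addn0 size_cat -addn1 eqn_add2l.
by case: c => [|l []] //= _; exists l; rewrite cats1.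
Qed.

Lemma par_leafP a b i : par (a, 0) (b, i.+1) -> a = b.
Proof.
move=> /andP[/and3P[_ /= /prefixP[c ->] _]].
rewrite /rank /= addn0 addn1 size_cat eqSS -[X in _ == X]addn0 eqn_add2l size_eq0.
by move=> /eqP ->; rewrite cats0.
Qed.

Lemma raw_tree_Q_trans M : transitive (raw_tree M symQ).
Proof.
move=> y x z /= /orP[xy|/andP[/eqP <- _]] // /orP[yz|/andP[/eqP <- _]].
  by rewrite (anc_trans xy yz).
by rewrite xy.
Qed.

(** An intersection of the two relations is preserved by every weak homomorphism, so parents go to
    parents even when nothing is reflected. *)
Lemma raw_tree_par M x y :
  par x y = raw_tree M symP x y && raw_tree M symQ x y.
Proof.
apply/idP/andP => [xy|[/= /orP[//|yx] /orP[xy|/andP[/eqP e _]]]].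
- by split; [rewrite /= xy|move: xy => /andP[/= -> _]].
- have := anc_rank xy; move: yx => /andP[_]; lia.
- by move: yx => /andP[]; rewrite e ancxx.
Qed.

(** The trace on nodes of a map that fixes the root and preserves parenthood. *)
Definition tree_map (k : seq L -> seq L) :=
  k [::] = [::] /\ forall a l, exists l', k (rcons a l) = rcons (k a) l'.

(** A node has a child, so its image has a child too and is a node. A mark on [a] is a loop at a
    child of the node [a]; the image of this child is a looped child of [k a], hence not the root
    but the first leaf of [k a]. *)
Lemma weakly_homomorphic_tree_map M M' : M [::] ->
  weakly_homomorphic (marked_tree M) (marked_tree M') ->
  exists2 k, tree_map k & forall a, M a -> M' (k a).
Proof.
move=> M0 [h hh].
have hpar u v : par (val u) (val v) -> par (val (h u)) (val (h v)).
  rewrite (raw_tree_par M) (raw_tree_par M') => /andP[/hh uP /hh uQ].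
  by apply/andP; split; [exact: uP|exact: uQ].
have hmark u : mark M (val u) -> mark M' (val (h u)).
  move=> m; have /hh : marked_tree M symQ u u.
    by rewrite /marked_tree /= ancxx eqxx m.
  by rewrite /marked_tree /= ancxx eqxx.
have h0 a : (val (h (node a))).2 = 0.
  exact: (par_fst0 (hpar (node a) (leaf1 a) (par_leaf a 0))).
pose k a := (val (h (node a))).1.
have hk a : val (h (node a)) = (k a, 0).
  by rewrite [LHS]surjective_pairing h0.
have k0 : k [::] = [::].
  have := hmark (node [::]); rewrite hk /mark /= xpair_eqE /= orbF.
  by move=> /(_ isT); rewrite andbT => /eqP.
exists k; first split=> // a l.
  have := hpar (node a) (node (rcons a l)) (par_rcons a l).
  by rewrite !hk; exact: par_nodeP.
move=> a Ma; have := hpar (node a) (leaf1 a) (par_leaf a 0); rewrite hk.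
have := hmark (leaf1 a); rewrite /mark /= Ma orbT => /(_ isT).
case: (val (h (leaf1 a))) => [b j] /= /orP[/eqP [-> ->]|/andP[/eqP -> Mb]].
  by move=> /andP[_]; rewrite /rank /= !addn0.
by move=> /par_leafP ->.
Qed.

Lemma tree_map_cat k a b : tree_map k -> exists c, k (a ++ b) = k a ++ c.
Proof.
move=> [_ kS]; elim/last_ind: b => [|b l [c IH]].
  by exists [::]; rewrite !cats0.
have [l' e] := kS (a ++ b) l.
by exists (rcons c l'); rewrite -rcons_cat e IH rcons_cat.
Qed.

Lemma tree_map_size k a : tree_map k -> size (k a) = size a.
Proof.
move=> [k0 kS]; elim/last_ind: a => [|a l IH]; first by rewrite k0.
by have [l' ->] := kS a l; rewrite !size_rcons IH.
Qed.

Lemma tree_map_take k a n : tree_map k -> k (take n a) = take n (k a).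
Proof.
move=> tk; have [c e] := tree_map_cat (take n a) (drop n a) tk.
move: e; rewrite cat_take_drop => e.
have [na|an] := leqP (size a) n.
  by rewrite !take_oversize ?(tree_map_size _ tk).
by rewrite e take_size_cat // (tree_map_size _ tk) size_takel // ltnW.
Qed.

Lemma tree_map_prefix k a b : tree_map k -> injective k ->
  prefix (k a) (k b) = prefix a b.
Proof.
move=> tk ik; rewrite !prefixE (tree_map_size _ tk) -(tree_map_take _ _ tk).
exact: (inj_eq ik).
Qed.

(** A looped leaf is represented by leaf 1 of its node, and every loopless one by leaf 2, which is
    loopless under all markings. *)
Definition leaf_class M x :=
  if x.2 == 0 then 0 else if (x.2 == 1) && M x.1 then 1 else 2.

Lemma leaf_class_eq0 M x : (leaf_class M x == 0) = (x.2 == 0).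
Proof. by rewrite /leaf_class; case: ifP => // _; case: ifP. Qed.

(** [M'] may mark [k a] where [M] does not mark [a]. Loops are reflected nevertheless, because the
    loopless leaf [(a, 1)] is then sent to leaf 2. *)
Lemma raw_tree_map M M' k s x y : tree_map k -> injective k ->
  (forall a, M a -> M' (k a)) ->
  raw_tree M s x y =
  raw_tree M' s (k x.1, leaf_class M x) (k y.1, leaf_class M y).
Proof.
move=> tk ik kM; set idx := leaf_class M.
have idx0 z : (idx z == 0) = (z.2 == 0) := leaf_class_eq0 M z.
have hanc u v : anc (k u.1, idx u) (k v.1, idx v) = anc u v.
  rewrite /anc /= (tree_map_prefix _ _ tk ik) idx0.
  case: eqP => //= u0; case: prefix => //=; congr (~~ _).
  case: u v u0 => [a i] [b j] /= ->; rewrite !xpair_eqE (inj_eq ik).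
  by congr (_ && _); rewrite {1}/idx /= [LHS]eq_sym idx0 eq_sym.
have hrank z : rank (k z.1, idx z) = rank z.
  by rewrite /rank /= (tree_map_size _ tk) idx0.
have hpar u v : par (k u.1, idx u) (k v.1, idx v) = par u v.
  by rewrite /par hanc !hrank.
case: s => /=; first by rewrite !hpar.
rewrite !hanc; case: (boolP (anc x y)) => //= _.
have hmark z : mark M' (k z.1, idx z) = mark M z.
  rewrite /mark /= !xpair_eqE idx0 -{1}tk.1 (inj_eq ik).
  case: z => [a i] /=; congr orb; rewrite /idx /leaf_class /=.
  case: i => [|[|i]] //=; case: ifP => //= Ma; exact: kM.
(* Only loopless leaves of one node are ever identified, so vertices with the same looped image are
   equal. *)
rewrite hmark; apply/andP/andP => -[/eqP e mx]; first by rewrite e eqxx -e.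
rewrite mx; split=> //; apply/eqP; move: e mx => [/ik].
case: x y => [a i] [b j] /= <-; rewrite /mark /= xpair_eqE.
case: i => [|[|i]]; rewrite /= ?andbF ?andbT ?orbF //.
  by move=> /eqP; rewrite eq_sym idx0 /= => /eqP ->.
rewrite /idx /leaf_class /= => e Ma; move: e; rewrite Ma.
by case: j => [|[|j]].
Qed.

Lemma tree_map_homomorphic M M' k : tree_map k -> injective k ->
  (forall a, M a -> M' (k a)) ->
  homomorphic (marked_tree M) (marked_tree M').
Proof.
move=> tk ik kM.
(* Classes are at most 2 and every node has at least two leaves, so the image exists whatever the
   number of leaves of [k a]. *)
have leaf_le (x : vertex) : leaf_class M (val x) <= leaf_count (k (val x).1).
  by rewrite /leaf_class; case: ifP => // _; case: ifP.
exists (fun u => exist _ (k (val u).1, leaf_class M (val u)) (leaf_le u)) => s u v.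
by rewrite /marked_tree /= (raw_tree_map _ _ _ tk ik kM).
Qed.

End MarkedTree.

(** Climbing to the parent reaches the root, by induction on the rank, which gives connectedness. In
    a cycle, both neighbours of a vertex of maximal rank are its parent, so they coincide, which is
    absurd. *)
Lemma combinatorial_treeP (e p : rel nat) (rk : nat -> nat) (root : nat) :
  (forall x y, e x y = p x y || p y x) ->
  (forall x y, p x y -> rk y = (rk x).+1) ->
  (forall x y z, p x z -> p y z -> x = y) ->
  (forall x, x = root \/ exists y, p y x) ->
  combinatorial_tree e.
Proof.
move=> eE prk puniq proot.
have esym : symmetric e by move=> x y; rewrite !eE orbC.
split=> // [x|x y|c c2 /andP[cyc uc]].
- by rewrite eE orbb; apply/negP => /prk; lia.
- pose conn u v := exists2 q, path e u q & last u q = v.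
  have conn_trans u v w : conn u v -> conn v w -> conn u w.
    move=> [q pq lq] [r pr lr]; exists (q ++ r).
      by rewrite cat_path pq lq pr.
    by rewrite last_cat lq.
  have conn1 u v : e u v -> conn u v by move=> uv; exists [:: v]; rewrite //= uv.
  suff croot n u : rk u <= n -> conn u root /\ conn root u.
    have [xr _] := croot _ _ (leqnn (rk x)).
    by have [_] := croot _ _ (leqnn (rk y)); exact: conn_trans.
  elim: n u => [|n IH] u; case: (proot u) => [-> _|[v vu]].
  + by split; exists [::].
  + by rewrite (prk _ _ vu).
  + by split; exists [::].
  + rewrite (prk _ _ vu) ltnS => /IH[vr rv].
    by split; [apply: conn_trans vr|apply: conn_trans rv _]; apply: conn1;
      rewrite eE vu ?orbT.
- have [x xc xmax] : exists2 x, x \in c & forall y, y \in c -> rk y <= rk x.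
    have c0 : 0 < size c by exact: leq_trans c2.
    case: (@arg_maxnP 'I_(size c) (Ordinal c0) xpredT (fun i => rk (nth 0 c i)))
      => // i _ imax.
    exists (nth 0 c i); first exact: mem_nth.
    move=> y yc; move: (yc); rewrite -index_mem => yi.
    by have := imax (Ordinal yi) isT; rewrite /= nth_index.
  have up y : y \in c -> e x y -> p y x.
    by move=> /xmax yx; rewrite eE => /orP[/prk|//]; lia.
  case: (rot_to xc) => i c' rc.
  move: cyc uc c2; rewrite -(rot_cycle i) -(rot_uniq i) -(size_rot i) rc.
  have mem y : y \in c' -> y \in c.
    by move=> yc'; rewrite -(mem_rot i) rc inE yc' orbT.
  case: c' {rc} mem => [|y [|z c']] //= mem.
  rewrite rcons_path => /and4P[xy _ _ lx] /and3P[_ yzc _] _.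
  have py : p y x by apply: up => //; apply: mem; rewrite inE eqxx.
  have pl : p (last z c') x.
    by apply: up; [apply: mem; rewrite inE mem_last orbT|rewrite esym].
  by move: yzc; rewrite (puniq _ _ _ py pl) mem_last.
Qed.

Section Enumeration.
Variables (L : countType) (beta : nat -> vertex L) (beta' : vertex L -> nat).
Hypotheses (betaK : cancel beta beta') (beta'K : cancel beta' beta).

Definition coded_tree (M : pred (seq L)) : omega_structure :=
  fun s i j => marked_tree M s (beta i) (beta j).

Lemma coded_tree_OCT M : OCT (coded_tree M).
Proof.
split; last by move=> y x z; exact: raw_tree_Q_trans.
apply: (@combinatorial_treeP _ (fun i j => par (val (beta i)) (val (beta j)))
  (fun i => rank (val (beta i))) (beta' (node [::]))) => //.
- by move=> x y /andP[_ /eqP].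
- move=> x y z; set b := val (beta z) => xz yz.
  apply: (can_inj betaK); apply: val_inj.
  move: xz yz; move: (val _) (val _) b.
  move=> [a i] [b j] [c k] /[dup] /par_fst0 /= -> ac.
  move=> /[dup] /par_fst0 /= -> bc; congr pair.
  case: k ac bc => [|k] ac bc; last by rewrite (par_leafP ac) (par_leafP bc).
  have [l cl] := par_nodeP ac; have [l' cl'] := par_nodeP bc.
  by have /rcons_inj[] := etrans (esym cl) cl'.
- move=> x; case e: (val (beta x)) => [a i].
  case: i e => [|i] e; last first.
    by right; exists (beta' (node a)); rewrite beta'K par_leaf.
  case/lastP: a e => [|a l] e; last first.
    by right; exists (beta' (node a)); rewrite beta'K par_rcons.
  by left; apply: (can_inj betaK); rewrite beta'K; apply: val_inj.
Qed.

Lemma homomorphic_coded_tree M M' :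
  homomorphic (marked_tree M) (marked_tree M') ->
  homomorphic (coded_tree M) (coded_tree M').
Proof.
move=> [h hh]; exists (beta' \o h \o beta) => s i j.
by rewrite /coded_tree /= !beta'K; exact: hh.
Qed.

Lemma weakly_homomorphic_coded_tree M M' :
  weakly_homomorphic (coded_tree M) (coded_tree M') ->
  weakly_homomorphic (marked_tree M) (marked_tree M').
Proof.
move=> [h hh]; exists (beta \o h \o beta') => s x y xy.
by apply: hh; rewrite /coded_tree !beta'K.
Qed.

End Enumeration.

Lemma countable_enumeration (T : countType) (f : nat -> T) : injective f ->
  exists (b : nat -> T) (b' : T -> nat), cancel b b' /\ cancel b' b.
Proof.
move=> f_inj; have : ([set: T]%classic #= [set: nat]%classic)%card.
  apply/eq_card_nat; first exact/countableP.
  have f_inj' : {in [set: nat]%classic &, injective f} by move=> x y _ _; exact: f_inj.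
  apply/infiniteP; rewrite -(card_le_eql (inj_card_eq f_inj')).
  exact/subset_card_le.
move=> /pcard_eqP/bijPex[b'].
by rewrite setTT_bijective => -[b b'K bK]; exists b, b'.
Qed.

(** * Borel sets of bit sequences *)

(** Inductive, so that Borel sets can be translated by induction into measurable sets, Souslin sets
    and formulas. *)
Inductive borel : set (nat -> bool) -> Prop :=
| borel_bit n : borel [set c | c n]
| borelC E : borel E -> borel (~` E)
| borel_bigcup (E : nat -> set (nat -> bool)) :
    (forall n, borel (E n)) -> borel (\bigcup_n E n).

Lemma borel_bigcap (E : nat -> set (nat -> bool)) :
  (forall n, borel (E n)) -> borel (\bigcap_n E n).
Proof.
move=> bE; rewrite -[X in borel X]setCK setC_bigcap.
by apply/borelC/borel_bigcup => n; exact: borelC.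
Qed.

Lemma borelT : borel setT.
Proof.
have -> : [set: nat -> bool] =
    \bigcup_n (if n is 0 then [set c | c 0] else ~` [set c | c 0]).
  apply/seteqP; split=> c // _; have [c0|c0] := boolP (c 0); first by exists 0.
  by exists 1 => //=; apply/negP.
by apply: borel_bigcup => -[|n]; [|apply: borelC]; exact: borel_bit.
Qed.

Lemma borel0 : borel set0.
Proof. by rewrite -setCT; exact/borelC/borelT. Qed.

Lemma borelU E F : borel E -> borel F -> borel (E `|` F).
Proof.
move=> bE bF; rewrite -bigcup2E; apply: borel_bigcup => -[|[|n]] //=.
exact: borel0.
Qed.

Lemma borelI E F : borel E -> borel F -> borel (E `&` F).
Proof.
move=> bE bF; rewrite -[X in borel X]setCK setCI.
by apply/borelC/borelU; exact: borelC.
Qed.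

Lemma borel_cst (P : Prop) : borel [set _ | P].
Proof.
have [p|np] := pselect P.
  by rewrite (_ : mkset _ = setT); [exact: borelT|apply/seteqP; split].
by rewrite (_ : mkset _ = set0); [exact: borel0|apply/seteqP; split].
Qed.

Lemma borel_exists (E : nat -> set (nat -> bool)) :
  (forall n, borel (E n)) -> borel [set c | exists n, E n c].
Proof.
move=> /borel_bigcup; rewrite (_ : \bigcup_n _ = [set c | exists n, E n c]) //.
by apply/seteqP; split=> c [n]; [move=> _|]; exists n.
Qed.

Lemma borel_forall (E : nat -> set (nat -> bool)) :
  (forall n, borel (E n)) -> borel [set c | forall n, E n c].
Proof.
move=> /borel_bigcap; rewrite (_ : \bigcap_n _ = [set c | forall n, E n c]) //.
by apply/seteqP; split=> c h n => [|_]; exact: h.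
Qed.

Lemma borel_imply E F : borel E -> borel F -> borel [set c | E c -> F c].
Proof.
move=> bE bF; rewrite (_ : mkset _ = ~` E `|` F); first exact/borelU/bF/borelC.
apply/seteqP; split=> c /=; last by case.
by have [Ec /(_ Ec)|] := pselect (E c); [right|left].
Qed.

(** Induction on [n]: split [E] by the value of bit [n]; once this bit is frozen, only the earlier
    bits matter. *)
Lemma borel_depends n (E : set (nat -> bool)) :
  (forall c c', (forall i, i < n -> c i = c' i) -> E c -> E c') -> borel E.
Proof.
elim: n E => [|n IH] E dE.
  rewrite (_ : E = [set _ | exists c, E c]); first exact: borel_cst.
  by apply/seteqP; split=> [c Ec|c [c' Ec']]; [exists c|exact: dE Ec'].
pose set_bit b (c : nat -> bool) i := if i == n then b else c i.
have bE b : borel (set_bit b @^-1` E).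
  apply: IH => c c' cc'; apply: dE => i iltn; rewrite /set_bit.
  by case: eqP => // /eqP i_n; apply: cc'; lia.
rewrite (_ : E = ([set c : nat -> bool | c n] `&` (set_bit true @^-1` E))
             `|` (~` [set c : nat -> bool | c n] `&` (set_bit false @^-1` E))).
  by apply: borelU; apply: borelI => //; [|apply: borelC]; exact: borel_bit.
have bitK c : E c = E (set_bit (c n) c).
  by congr E; apply/funext => i; rewrite /set_bit; case: eqP => [->|].
apply/seteqP; split=> c /=.
  by rewrite [X in X -> _]bitK; case: (c n); [left|right].
by move=> [[cn]|[/negP/negbTE cn]]; rewrite [E c]bitK cn.
Qed.

Lemma measurable_borel d (X : measurableType d) (e : X -> nat -> bool) E :
  (forall n, measurable [set x | e x n]) -> borel E ->
  measurable [set x | E (e x)].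
Proof.
move=> me; elim=> [n|{}E _ mE|{}E _ mE]; first exact: me.
  exact: measurableC mE.
rewrite (_ : mkset _ = \bigcup_n [set x | E n (e x)]); first exact: bigcup_measurable.
by apply/seteqP; split.
Qed.

(** * Bit sequences as codes for the points of a Polish space *)

Section PolishCode.
Variables (K : realType) (Y : metricType K).
Local Open Scope ring_scope.

Let eps (k : nat) : K := k.+1%:R^-1.

Let eps_gt0 k : 0 < eps k. Proof. by rewrite invr_gt0 ltr0n. Qed.

Let eps_lt (x : K) : 0 < x -> exists k, eps k < x.
Proof. by move=> /ltr_add_invr[k]; rewrite add0r; exists k. Qed.

Let eps_le k l : (k <= l)%N -> eps l <= eps k.
Proof. by move=> kl; rewrite lef_pV2 ?posrE ?ltr0n // ler_nat ltnS. Qed.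

Lemma open_metric_ball (y : Y) (x : K) : open (ball y x).
Proof.
rewrite openE => z; rewrite ballEmdist /= => yz; apply/nbhs_ballP.
exists (x - mdist y z) => /=; first by rewrite subr_gt0.
move=> t; rewrite ballEmdist /= => zt.
by have := metric_triangle y z t; lra.
Qed.

Lemma open_metricP (U : set Y) (y : Y) : open U -> U y ->
  exists2 x : K, 0 < x & forall z, mdist y z < x -> U z.
Proof.
rewrite openE => oU /oU /nbhs_ballP[x /= x0 xU]; exists x => // z yz.
by apply: xU; rewrite ballEmdist.
Qed.

Variable d : nat -> Y.
Hypothesis d_dense : forall y (x : K), 0 < x -> exists i, mdist (d i) y < x.
Hypothesis Y_complete : forall F : set_system Y, ProperFilter F -> cauchy F ->
  exists y : Y, F --> y.

Let close k i y := mdist (d i) y < eps k.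

(* The code of y records the balls to which y belongs; decoding takes the limit
   of the first centres recorded for each radius. *)
Definition polish_code (y : Y) (n : nat) : bool :=
  if @unpickle (nat * nat)%type n is Some (k, i) then `[< close k i y >] else false.

Let bit (k i : nat) : nat := pickle (k, i).

Let polish_codeE y k i : polish_code y (bit k i) = `[< close k i y >].
Proof. by rewrite /polish_code pickleK. Qed.

Let first (c : nat -> bool) k i :=
  c (bit k i) /\ forall j, (j < i)%N -> ~ c (bit k j).

(** What makes the first recorded centres a Cauchy sequence. Codes of points satisfy it by density
    and the triangle inequality. *)
Let good (c : nat -> bool) := (forall k, exists i, c (bit k i)) /\
  forall k l i j, first c k i -> first c l j -> mdist (d i) (d j) < eps k + eps l.

Let good_first c k : good c -> exists i, first c k i.
Proof.
move=> [/(_ k) ex _]; case: (ex_minnP ex) => i ci imin; exists i; split=> // j ji.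
by move=> /imin; rewrite leqNgt ji.
Qed.

(** For [l >= k], the first centres of radii [eps k] and [eps l] are less than [2 * eps k] apart,
    and a large [l] brings the second one within [eps k] of the limit; hence the factor 3. *)
Let limit_of c y := forall k i, first c k i -> mdist (d i) y < 3 * eps k.

Let good_limit c : good c -> exists y, limit_of c y.
Proof.
move=> gc; have [u fu] := choice (fun k => good_first k gc).
have [y uy] : exists y : Y, ((fun k => d (u k)) @ \oo) --> y.
  apply: Y_complete; apply/cauchy_ballP => x x0.
  have [k kx] := eps_lt (divr_gt0 x0 (ltr0n K 2)).
  exists ([set d (u l) | l in [set l | (k <= l)%N]],
          [set d (u l) | l in [set l | (k <= l)%N]]).
    by split; exists k => // l kl; exists l.
  move=> [_ _] [/= [l kl <-] [m km <-]]; rewrite ballEmdist /=.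
  have := gc.2 _ _ _ _ (fu l) (fu m); have := eps_le kl; have := eps_le km; lra.
exists y => k i fi.
have [m _ um] : \forall l \near \oo, mdist y (d (u l)) < eps k.
  have /(_ _ (nbhsx_ballx y _ (eps_gt0 k))) := uy.
  by rewrite ballEmdist.
pose l := maxn k m.
have := um l (leq_maxr _ _); rewrite /= metric_sym.
have := gc.2 _ _ _ _ fi (fu l); have := eps_le (leq_maxl k m).
have := metric_triangle (d i) (d (u l)) y; rewrite -/l; lra.
Qed.

Let polish_code_first y k i : first (polish_code y) k i -> mdist (d i) y < eps k.
Proof. by move=> [+ _]; rewrite polish_codeE => /asboolP. Qed.

Let good_polish_code y : good (polish_code y).
Proof.
split=> [k|k l i j /polish_code_first iy /polish_code_first jy].
  have [i iy] := d_dense y (eps_gt0 k).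
  by exists i; rewrite polish_codeE; apply/asboolP.
have := metric_triangle (d i) y (d j); rewrite (metric_sym y); lra.
Qed.

(** All codes that are not good share the value [d 0], which keeps the decoding Borel. *)
Definition polish_decode (c : nat -> bool) : Y :=
  xget (d 0) (limit_of c `&` [set _ | good c]).

Let polish_decode_good c : good c -> limit_of c (polish_decode c).
Proof.
move=> gc; have [y yc] := good_limit gc; rewrite /polish_decode.
by case: xgetP => [_ _ []|/(_ y)] // [].
Qed.

Let polish_decode_bad c : ~ good c -> polish_decode c = d 0.
Proof. by move=> gc; rewrite /polish_decode; case: xgetP => // y _ [_ /gc]. Qed.

Lemma polish_codeK : cancel polish_code polish_decode.
Proof.
move=> y; apply/esym/eqP; apply: contraT; rewrite -mdist_gt0 => yy'.
(* The first centre is within [eps k] of [y] and within [3 * eps k] of the decoded point, hence the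
   factor 4. *)
have [k ky] := eps_lt (divr_gt0 yy' (ltr0n K 4)).
have gy := good_polish_code y; have [i fi] := good_first k gy.
have := polish_decode_good gy fi; have := polish_code_first fi.
rewrite metric_sym.
have := metric_triangle y (d i) (polish_decode (polish_code y)); lra.
Qed.

Let borel_first k i : borel [set c | first c k i].
Proof.
apply: borelI; first exact: borel_bit.
apply: borel_forall => j; apply: borel_imply; first exact: borel_cst.
exact/borelC/borel_bit.
Qed.

Let borel_good : borel good.
Proof.
apply: borelI.
  by apply: borel_forall => k; apply: borel_exists => i; exact: borel_bit.
do 4 (apply: borel_forall => ?).
do 2 (apply: borel_imply; first exact: borel_first).
exact: borel_cst.
Qed.

(** For [U] open, a good code is decoded into [U] iff, for some [k], the ball of radius [3 * eps k]
    around its first centre lies in [U]. This is a countable union of conditions on finitely many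
    bits. *)
Lemma borel_polish_decode (B : set Y) :
  <<s @open Y >> B -> borel (polish_decode @^-1` B).
Proof.
move=> sB; apply: (sB (fun A => borel (polish_decode @^-1` A))); split.
  split; first exact: borel0.
    by move=> A bA; rewrite setTD; exact: borelC bA.
  by move=> A bA; rewrite preimage_bigcup; exact: borel_bigcup.
move=> U oU /=.
rewrite (_ : _ @^-1` U = [set c | good c -> exists k i,
    first c k i /\ (forall y, mdist (d i) y < 3 * eps k -> U y)]
    `&` [set c | ~ good c -> U (d 0)]).
  apply: borelI; (apply: borel_imply; last 1 first).
  - do 2 (apply: borel_exists => ?).
    by apply: borelI; [exact: borel_first|exact: borel_cst].
  - exact: borel_good.
  - exact: borel_cst.
  - exact/borelC/borel_good.
apply/seteqP; split=> c /=.
  move=> Uc; split=> [gc|/polish_decode_bad <-] //.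
  have [x x0 xU] := open_metricP oU Uc.
  (* Both the decoded point and [y] are within [3 * eps k] of [d i], hence the factor 6. *)
  have [k kx] := eps_lt (divr_gt0 x0 (ltr0n K 6)).
  have [i fi] := good_first k gc; exists k, i; split=> // y iy; apply: xU.
  have := polish_decode_good gc fi.
  have := metric_triangle (polish_decode c) (d i) y.
  rewrite (metric_sym (polish_decode c) (d i)); lra.
move=> [gU bU]; have [gc|bc] := pselect (good c); last first.
  by rewrite polish_decode_bad //; exact: bU.
by have [k [i [fi]]] := gU gc; apply; exact: polish_decode_good.
Qed.

Lemma open_polish_code n : <<s @open Y >> [set y | polish_code y n].
Proof.
rewrite /polish_code; case: unpickle => [[k i]|]; last first.
  by rewrite (_ : mkset _ = set0); [exact: sigma_algebra0|apply/seteqP; split].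
apply: sub_sigma_algebra; rewrite (_ : mkset _ = ball (d i) (eps k)).
  exact: open_metric_ball.
by rewrite ballEmdist; apply/seteqP; split=> y /=; move/asboolP.
Qed.

End PolishCode.

(** As the left inverse [r] is Borel and total, the range of [e] is the Borel set of all [c] with
    [e (r c) = c]. *)
Lemma standard_borel_retract (K : realType) d (X : measurableType d) :
  standard_borel K X ->
  exists (e : X -> nat -> bool) (r : (nat -> bool) -> X),
    [/\ forall n, measurable [set x | e x n],
        forall B, measurable B -> borel (r @^-1` B) & cancel e r].
Proof.
move=> [Y [f [[Y_complete [D Dc Dd]] [g fK gK] f_borel]]].
have D0 : D !=set0.
  have [y []] := Dd setT (ex_intro _ (f point) I) openT.
  by move=> _ Dy; exists y.
have [u uD] : exists u : nat -> Y, D `<=` range u.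
  have [z Dz] := D0; have /countable_injP[h h_inj] := Dc.
  exists (fun n => xget z (D `&` [set y | h y = n])) => y Dy.
  exists (h y) => //; case: xgetP => [y' _ [Dy' /= hy]|/(_ y)[]//].
  by apply: h_inj => //; rewrite inE.
have u_dense y (x : K) : (0 < x)%R -> exists i, (mdist (u i) y < x)%R.
  move=> x0; have [z [yz /uD[i _ iz]]] :=
    Dd _ (ex_intro _ y (ballxx y x0)) (open_metric_ball y x).
  have : ball y x (u i) by rewrite iz.
  by rewrite ballEmdist => yu; exists i; rewrite metric_sym.
exists (polish_code u \o f), (g \o polish_decode u); split.
- move=> n; apply/(f_borel [set y | polish_code u y n]).
  exact: open_polish_code.
- move=> B mB; rewrite (_ : _ @^-1` B = polish_decode u @^-1` (g @^-1` B)) //.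
  apply: (@borel_polish_decode K Y u Y_complete (g @^-1` B)); apply/f_borel.
  rewrite (_ : _ @^-1` _ = B) //.
  by apply/seteqP; split=> x /=; rewrite fK.
- by move=> x /=; rewrite (polish_codeK u_dense Y_complete) fK.
Qed.

(** * Souslin representation of analytic relations *)

(** Closedness in the product of countably many copies of the discrete space [T]. *)
Definition closed_seq (T : Type) (F : set (nat -> T)) :=
  forall g, (forall n, exists2 g', (forall i, i < n -> g i = g' i) & F g') -> F g.

(** [m] is continuous, with [bound] as a modulus of continuity. *)
Lemma closed_seq_preimage (T T' : Type) (m : (nat -> T) -> nat -> T')
    (bound : nat -> nat) (F : set (nat -> T')) :
  (forall i g g', (forall j, j < bound i -> g j = g' j) -> m g i = m g' i) ->
  closed_seq F -> closed_seq (m @^-1` F).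
Proof.
move=> mb cF g gF; apply: cF => n.
have [g' gg' Fg'] := gF (\max_(i < n) bound i).
exists (m g') => // i iltn; apply: mb => j jb; apply: gg'.
exact: leq_trans jb (leq_bigmax (Ordinal iltn)).
Qed.

Lemma closed_seq_forall (T : Type) (F : nat -> set (nat -> T)) :
  (forall k, closed_seq (F k)) -> closed_seq [set g | forall k, F k g].
Proof.
move=> cF g gF k; apply: cF => n; have [g' gg' Fg'] := gF n.
by exists g'.
Qed.

Definition souslin (E : set (nat -> bool)) :=
  exists2 F : set (nat -> bool * nat), closed_seq F &
    forall c, E c <-> exists z, F (fun i => (c i, z i)).

Lemma souslin_choice (E : nat -> set (nat -> bool)) :
  (forall n, souslin (E n)) -> exists F : nat -> set (nat -> bool * nat),
    forall n, closed_seq (F n) /\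
      forall c, E n c <-> exists z, F n (fun i => (c i, z i)).
Proof.
move=> sE.
have /choice[F FE] n : exists F : set (nat -> bool * nat), closed_seq F /\
    forall c, E n c <-> exists z, F (fun i => (c i, z i)).
  by have [F] := sE n; exists F.
by exists F.
Qed.

(** The first entry of the witness names the index, and its tail is a witness for the set with this
    index. *)
Lemma souslin_bigcup (E : nat -> set (nat -> bool)) :
  (forall n, souslin (E n)) -> souslin (\bigcup_n E n).
Proof.
move=> sE.
have [F FE] := souslin_choice sE.
exists [set w | F (w 0).2 (fun i => ((w i).1, (w i.+1).2))].
  move=> w wF; have [cF _] := FE (w 0).2; apply: cF => n.
  have [w' ww' Fw'] := wF n.+1.
  exists (fun i => ((w' i).1, (w' i.+1).2)); last by rewrite ww'.
  by move=> i iltn; rewrite !ww' // ltnW.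
move=> c; split.
  move=> [k _ /(FE k).2[z Fz]].
  by exists (fun i => if i is j.+1 then z j else k).
by move=> [z Fz]; exists (z 0) => //; apply/(FE _).2; eexists; exact: Fz.
Qed.

(** One witness interleaves, by means of [pickle], witnesses for all the sets. *)
Lemma souslin_bigcap (E : nat -> set (nat -> bool)) :
  (forall n, souslin (E n)) -> souslin (\bigcap_n E n).
Proof.
move=> sE.
have [F FE] := souslin_choice sE.
exists [set w | forall k, F k (fun i => ((w i).1, (w (pickle (k, i))).2))].
  apply: closed_seq_forall => k.
  apply: (@closed_seq_preimage _ _
    (fun w i => ((w i).1, (w (pickle (k, i))).2))
    (fun i => (i + pickle (k, i)).+1)) (FE k).1.
  by move=> i g g' gg'; rewrite !gg' //; lia.
move=> c; split=> [Ec|[z Fz] k _].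
  have /choice[z Fz] k : exists z, F k (fun i => (c i, z i)).
    exact/(FE k).2/Ec.
  exists (fun j => if @unpickle (nat * nat)%type j is Some (k, i) then z k i else 0).
  move=> k /=; rewrite (_ : (fun i => _) = (fun i => (c i, z k i))) //.
  by apply/funext => i; rewrite pickleK.
apply/(FE k).2; exists (fun i => z (pickle (k, i))); exact: Fz.
Qed.

Lemma souslin_bits (b : bool) n : souslin [set c | c n = b].
Proof.
exists [set w | (w n).1 = b]; last first.
  by move=> c; split=> [cn|[]//]; exists (fun=> 0).
by move=> w /(_ n.+1)[w' ww' wn] /=; rewrite ww'.
Qed.

(** The complement is carried along because the induction has to pass through [borelC]. *)
Lemma borel_souslin E : borel E -> souslin E /\ souslin (~` E).
Proof.
elim=> [n|{}E _ [sE sCE]|{}E _ sE].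
- split; first exact: (souslin_bits true).
  rewrite (_ : ~` _ = [set c | c n = false]); first exact: souslin_bits.
  by apply/seteqP; split=> c /=; [move=> /negP/negbTE|move=> ->].
- by rewrite setCK.
- split; first by apply: souslin_bigcup => n; exact: (sE n).1.
  by rewrite setC_bigcup; apply: souslin_bigcap => n; exact: (sE n).2.
Qed.

Lemma borel_preimage (e : (nat -> bool) -> nat -> bool) E :
  (forall n, borel [set c | e c n]) -> borel E -> borel [set c | E (e c)].
Proof.
move=> be; elim=> [n|{}E _ bE|{}E _ bE]; first exact: be.
  exact: borelC bE.
rewrite (_ : mkset _ = \bigcup_n [set c | E n (e c)]); first exact: borel_bigcup.
by apply/seteqP; split.
Qed.

Lemma borel_iff E F : borel E -> borel F -> borel [set c | E c <-> F c].
Proof.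
move=> bE bF; rewrite (_ : mkset _ = [set c | E c -> F c] `&` [set c | F c -> E c]).
  by apply: borelI; exact: borel_imply.
by apply/seteqP; split=> c [].
Qed.

(** [F] and [G] are the coordinates of two Borel maps, and the relation is the image of [B] under
    the pair of them. The graph of this pair over [B] is Borel, hence Souslin; projecting the point
    of [B] away only enlarges the witness. *)
Lemma souslin_relation (B : set (nat -> bool)) (F G : nat -> set (nat -> bool)) :
  borel B -> (forall n, borel (F n)) -> (forall n, borel (G n)) ->
  exists2 Phi : set (nat -> bool * bool * nat), closed_seq Phi &
    forall a b, (exists z, Phi (fun i => (a i, b i, z i))) <->
      exists2 c, B c & forall n, (a n <-> F n c) /\ (b n <-> G n c).
Proof.
move=> bB bF bG.
(* c codes a, b and a third point; z codes the third point and a witness. *)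
pose part (c : nat -> bool) (k i : nat) := c (pickle (k, i)).
pose E := [set c | B (part c 2) /\ forall n,
  (part c 0 n <-> F n (part c 2)) /\ (part c 1 n <-> G n (part c 2))].
have bE : borel E.
  have bp D : borel D -> borel [set c | D (part c 2)].
    by apply: borel_preimage => n; exact: borel_bit.
  apply: borelI; first exact: bp.
  apply: borel_forall => n; apply: borelI; apply: borel_iff; rewrite ?/part;
    by [exact: borel_bit|exact: (bp (F n))|exact: (bp (G n))].
have [[Psi cPsi PsiE] _] := borel_souslin bE.
(* The entries of [z] at [pickle (0, n)] are the bits of the third point, nonzero meaning true;
   those at [pickle (1, i)] are the witness. *)
pose join (a b : nat -> bool) (z : nat -> nat) i :=
  if @unpickle (nat * nat)%type i is Some (k, n) then
    match k with 0 => a n | 1 => b n | _ => z (pickle (0, n)) != 0 end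
  else false.
pose m (w : nat -> bool * bool * nat) i :=
  (join (fun i => (w i).1.1) (fun i => (w i).1.2) (fun i => (w i).2) i,
   (w (pickle (1, i))).2).
exists (m @^-1` Psi).
  apply: (@closed_seq_preimage _ _ m (fun i => (pickle (1, i) +
    if @unpickle (nat * nat)%type i is Some (k, n) then n + pickle (0, n)
    else 0).+1)) => //.
  move=> i g g' gg'; rewrite /m gg'; last by lia.
  congr pair; rewrite /join; case: unpickle gg' => [[k n]|] // gg'.
  by case: k => [|[|k]]; rewrite gg' //; lia.
have part_join a b z : [/\ part (join a b z) 0 = a, part (join a b z) 1 = b &
    part (join a b z) 2 = (fun i => z (pickle (0, i)) != 0)].
  by split; apply/funext => i; rewrite /part /join pickleK.
move=> a b; split=> [[z Psiz]|[c Bc abc]].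
  have /PsiE[] : exists z', Psi (fun i => (join a b z i, z' i)).
    by exists (fun i => z (pickle (1, i))).
  by have [-> -> ->] := part_join a b z; eexists; eassumption.
have /PsiE[z Psiz] : E (join a b (fun j =>
    if @unpickle (nat * nat)%type j is Some (0, i) then c i : nat else 0)).
  have cE : (fun i => (if @unpickle (nat * nat)%type (pickle (0, i))
      is Some (0, i) then c i : nat else 0) != 0) = c.
    by apply/funext => i; rewrite pickleK eqb0 negbK.
  by rewrite /E /=; have [-> -> ->] := part_join a b (fun j =>
    if @unpickle (nat * nat)%type j is Some (0, i) then c i : nat else 0);
    rewrite cE.
exists (fun j => if @unpickle (nat * nat)%type j is Some (k, i) then
  (if k is 0 then c i : nat else z i) else 0).
rewrite /preimage /=; rewrite (_ : m _ = (fun i => (join a b (fun j =>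
    if @unpickle (nat * nat)%type j is Some (0, i) then c i : nat else 0) i, z i))) //.
apply/funext => i; rewrite /m pickleK; congr pair; rewrite /join.
by case: unpickle => [[[|[|k]] n]|] //; rewrite !pickleK.
Qed.

Lemma analytic_relation (K : realType) d (X : measurableType d) (A : set X)
    (R : X -> X -> Prop) (e : X -> nat -> bool) :
  (forall n, measurable [set x | e x n]) ->
  analytic K [set p : X * X | [/\ A p.1, A p.2 & R p.1 p.2]] ->
  exists2 Phi : set (nat -> bool * bool * nat), closed_seq Phi &
    forall a b, (exists z, Phi (fun i => (a i, b i, z i))) <->
      exists x y, [/\ A x, A y, R x y, a = e x & b = e y].
Proof.
move=> me [d' [Z [B [f [sZ mB mf imf]]]]].
have [eZ [r [_ br rK]]] := standard_borel_retract sZ.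
(* [f] is measurable on [B] only, hence the intersection with [B]. *)
have bF (g : X * X -> X) n : measurable_fun setT g ->
    borel (r @^-1` (B `&` f @^-1` [set p | e (g p) n])).
  move=> mg; apply: br; apply: mf => //.
  by rewrite -[X in measurable X]setTI; exact: (mg measurableT _ (me n)).
have [Phi cPhi PhiE] := souslin_relation (br _ mB)
  (fun n => bF fst n measurable_fst) (fun n => bF snd n measurable_snd).
exists Phi => // a b; rewrite PhiE; split.
  move=> [c Bc abc]; have : (f @` B) (f (r c)) by exists (r c).
  rewrite -imf /= => -[A1 A2 R12]; exists (f (r c)).1, (f (r c)).2.
  by split=> //; apply/funext => n; have [[a1 a2] [b1 b2]] := abc n;
    apply/idP/idP => h; by [case: (a1 h)|apply: a2|case: (b1 h)|apply: b2].
move=> [x [y [Ax Ay Rxy -> ->]]].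
have : [set p : X * X | [/\ A p.1, A p.2 & R p.1 p.2]] (x, y) by [].
rewrite imf => -[z Bz fz]; exists (eZ z); first by rewrite /preimage /= rK.
move=> n; rewrite /preimage /= !rK fz /=.
by split; split=> [|[]].
Qed.

(** * Chains of approximations *)

(** The letter at index [i] is a column of a chain w_0, ..., w_m: it lists the [i]-th bits of
    w_(m-1), ..., w_0, each with the [i]-th value of the witness for the link that leaves this
    point. *)
Notation letter := (seq (bool * nat)).

Section Chains.
Variable Phi : set (nat -> bool * bool * nat).
Implicit Types (a b c w : nat -> bool) (z t : nat -> nat) (s : nat -> letter).
Implicit Types (u : seq bool) (p : seq (option letter)).

Definition related a b := exists z, Phi (fun i => (a i, b i, z i)).

Definition approx n a b z :=
  exists2 g, Phi g & forall i, i < n -> g i = (a i, b i, z i).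

Definition head_bit s i := (head (false, 0) (s i)).1.
Definition head_nat s i := (head (false, 0) (s i)).2.

(** [m] is the number of links, read from the end [b] back to the start [a]. Only the indices below
    [n] count, but each link has to extend to a full element of [Phi]. *)
Fixpoint chain m n a s b : Prop :=
  if m is m'.+1 then
    [/\ forall i, i < n -> s i != [::],
        approx n (head_bit s) b (head_nat s) &
        chain m' n a (fun i => behead (s i)) (head_bit s)]
  else forall i, i < n -> s i = [::] /\ a i = b i.

Lemma eq_chain m n a a' s s' b b' :
  (forall i, i < n -> [/\ a i = a' i, s i = s' i & b i = b' i]) ->
  chain m n a s b -> chain m n a' s' b'.
Proof.
elim: m s s' b b' => [|m IH] s s' b b' e /=.
  by move=> h i iltn; have [<- <- <-] := e i iltn; exact: h.
move=> [s0 [g Pg gE] ch]; split.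
- by move=> i iltn; have [_ <- _] := e i iltn; exact: s0.
- exists g => // i iltn; rewrite gE //; have [_ es <-] := e i iltn.
  by rewrite /head_bit /head_nat es.
- apply: IH ch => i iltn; have [-> es _] := e i iltn.
  by rewrite /head_bit es.
Qed.

Lemma chain_leq m n n' a s b : n <= n' -> chain m n' a s b -> chain m n a s b.
Proof.
move=> nn'; elim: m s b => [|m IH] s b /=.
  by move=> h i iltn; apply: h; exact: leq_trans nn'.
move=> [s0 [g Pg gE] ch]; split; last exact: IH.
- by move=> i iltn; apply: s0; exact: leq_trans nn'.
- by exists g => // i iltn; apply: gE; exact: leq_trans nn'.
Qed.

Lemma chain_cons m n a s b c z : Phi (fun i => (b i, c i, z i)) ->
  chain m n a s b -> chain m.+1 n a (fun i => (b i, z i) :: s i) c.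
Proof. by move=> Phiz ch; split => //; eexists; first exact: Phiz. Qed.


Hypothesis closed_Phi : closed_seq Phi.
Hypothesis related_trans : forall a b c,
  related a b -> related b c -> related a c.

(** The links do not change with [n], so closedness makes each of them a true instance of [related],
    and transitivity contracts the chain. Without links the two ends are equal. *)
Lemma chain_related m a s b :
  (forall n, chain m n a s b) -> a = b \/ related a b.
Proof.
elim: m s b => [|m IH] s b ch.
  by left; apply/funext => i; have [] := ch i.+1 i (ltnSn i).
have ab : related (head_bit s) b.
  exists (head_nat s); apply: closed_Phi => n.
  by have [_ [g Pg gE] _] := ch n; exists g => // i iltn; rewrite gE.
have [n|->|ah] := IH (fun i => behead (s i)) (head_bit s).
- by have [] := ch n.
- by right.
- by right; exact: related_trans ah ab.
Qed.

(* The homomorphisms of marked trees only see the length of a marked sequence,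
   which therefore determines u. *)
Definition level u := CodeSeq.code [:: size u; pickle u].

(** The node whose looped leaf attaches the label [u] to [s]: the letters [None] spell the path from
    [s] down to the level of [u]. *)
Definition word (s : seq letter) u : seq (option letter) :=
  map Some s ++ nseq (level u - size u) None.

(** The number of links is read off the first letter, so that one tree accommodates chains of all
    lengths. *)
Definition marked c p := p = [::] \/ exists (s : seq letter) u,
  [/\ size s = size u, p = word s u &
      chain (size (nth [::] s 0)) (size u) (nth false u) (nth [::] s) c].

Lemma level_inj : injective level.
Proof.
move=> u v /(can_inj CodeSeq.codeK)[_ h]; exact: (pcan_inj pickleK).
Qed.

Lemma size_lt_level u : size u < level u.
Proof. by have := CodeSeq.ltn_code [:: size u; pickle u] => /andP[]. Qed.

Lemma size_word (s : seq letter) u : size s = size u -> size (word s u) = level u.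
Proof.
by move=> su; rewrite size_cat size_map size_nseq su subnKC // ltnW ?size_lt_level.
Qed.

Lemma take_word (s : seq letter) u : take (size s) (word s u) = map Some s.
Proof. by rewrite /word -(size_map Some s) take_size_cat. Qed.

Lemma word_inj (s s' : seq letter) u u' : size s = size u -> size s' = size u' ->
  word s u = word s' u' -> s = s' /\ u = u'.
Proof.
move=> su su' e; have uu' : u = u'.
  by apply: level_inj; rewrite -(size_word su) -(size_word su') e.
split=> //; have := congr1 (take (size s)) e.
rewrite take_word su uu' -su' take_word => /inj_map; apply.
by move=> ? ? [].
Qed.

Lemma marked_word c (s : seq letter) u : size s = size u -> marked c (word s u) <->
  chain (size (nth [::] s 0)) (size u) (nth false u) (nth [::] s) c.
Proof.
move=> su; split=> [[e|]|]; last by right; exists s, u.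
- by have := size_lt_level u; rewrite -(size_word su) e.
- by move=> [s' [u' [su' /word_inj[] // -> ->]]].
Qed.

(** The chain consults [c] only below [size u], and [size u] is less than [level u], the length of
    [p]. *)
Lemma marked_depends c c' p : (forall i, i < size p -> c i = c' i) ->
  marked c p -> marked c' p.
Proof.
move=> cc' [->|[s [u [su pE ch]]]]; first by left.
right; exists s, u; split=> //; apply: eq_chain ch => i iltn; split=> //.
by apply: cc'; rewrite pE size_word //; exact: ltn_trans (size_lt_level u).
Qed.

(** Put [(a i, z i)] in front of the letter at index [i] and leave [None] alone: a chain to [a]
    becomes a chain to [b] with one more link, while its label and its length stay the same. *)
Lemma related_tree_map a b : related a b -> exists k : seq _ -> seq _,
  [/\ tree_map k, injective k & forall p, marked a p -> marked b (k p)].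
Proof.
move=> [z Phiz].
pose step i (l : option letter) := omap (cons (a i, z i)) l.
pose k p := mkseq (fun i => step i (nth None p i)) (size p).
exists k; split.
- split=> // p l; exists (step (size p) l).
  rewrite /k size_rcons mkseqS nth_rcons ltnn eqxx; congr rcons.
  by apply/eq_in_map => i; rewrite mem_iota add0n nth_rcons => /= ->.
- move=> p q kpq; have := congr1 size kpq; rewrite !size_mkseq => spq.
  apply: (eq_from_nth (x0 := None)) => // i ip.
  have := congr1 (fun p => nth None p i) kpq.
  rewrite /k !nth_mkseq -?spq // /step.
  by case: (nth None p i) (nth None q i) => [l|] [l'|] // [->].
- move=> _ [->|[s [u [su -> ch]]]]; first by left.
  right; exists (mkseq (fun i => (a i, z i) :: nth [::] s i) (size s)), u.
  rewrite size_mkseq; split=> //.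
    apply: (eq_from_nth (x0 := None)) => [|i].
      by rewrite size_mkseq !size_word // size_mkseq.
    rewrite size_mkseq => ip; rewrite nth_mkseq // /word !nth_cat !size_map size_iota.
    case: ltnP => i_s; last by rewrite nth_nseq if_same.
    by rewrite (nth_map [::]) // (nth_map [::]) ?size_mkseq // nth_mkseq.
  (* For empty [s] the first letter is the default [[::]] and no link is gained, but a chain of
     length 0 without links is vacuous. *)
  case: (posnP (size s)) => [s0|s0].
    by rewrite s0 /= -su s0 => i.
  rewrite nth_mkseq //=.
  have := chain_cons Phiz ch; apply: eq_chain => i iu; split=> //.
  by rewrite nth_mkseq ?su.
Qed.

(** For each [n] the chain without links from [a] to itself is marked with label the first [n] bits
    of [a]. Its image is a chain from [a] to [b] of the same length, and since [k] commutes with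
    [take], these images are the initial segments of one branch [sigma]. *)
Lemma tree_map_related a b k : tree_map k ->
  (forall p, marked a p -> marked b (k p)) -> a = b \/ related a b.
Proof.
move=> tk kM.
pose restr n := mkseq a n.
have /choice[s sP] n : exists s : seq letter, [/\ size s = n,
    k (nseq n (Some [::])) = map Some s &
    chain (size (nth [::] s 0)) n a (nth [::] s) b].
  have sn : size (nseq n ([::] : letter)) = size (restr n).
    by rewrite size_nseq size_mkseq.
  have /kM : marked a (word (nseq n [::]) (restr n)).
    apply/(marked_word _ sn); rewrite size_mkseq.
    have -> : size (nth [::] (nseq n ([::] : letter)) 0) = 0.
      by rewrite nth_nseq if_same.
    by move=> i iltn /=; rewrite nth_nseq iltn nth_mkseq.
  move=> [e|[s [u [su kE ch]]]].
    have := size_lt_level (restr n).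
    by rewrite -(size_word sn) -(tree_map_size _ tk) e.
  (* [k] preserves lengths, and the length of a marked word determines its label. *)
  have ur : u = restr n.
    apply: level_inj; rewrite -(size_word su) -(size_word sn) -kE.
    exact: tree_map_size.
  have sn' : size s = n by rewrite su ur size_mkseq.
  exists s; split=> //.
    rewrite -(take_word s u) -kE sn' -(tree_map_take _ _ tk); congr k.
    by rewrite -[X in take X](size_nseq n ([::] : letter)) take_word map_nseq.
  move: ch; rewrite ur size_mkseq => ch; apply: eq_chain ch => i iltn; split=> //.
  by rewrite nth_mkseq.
have sS m n : n <= m -> s n = take n (s m).
  move=> nm; have [_ kn _] := sP n; have [_ km _] := sP m.
  have : map Some (s n) = map Some (take n (s m)).
    by rewrite map_take -kn -km -(tree_map_take _ _ tk) take_nseq.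
  by move=> /inj_map; apply=> ? ? [].
pose sigma i := nth [::] (s i.+1) i.
have sigmaE n i : i < n -> nth [::] (s n) i = sigma i.
  by move=> iltn; rewrite /sigma (sS n i.+1) // nth_take.
apply: (@chain_related (size (sigma 0)) a sigma) => n.
(* At length [n.+1] the first letter is [sigma 0] and not the default, so the number of links is the
   same for all [n]. *)
have [_ _ ch] := sP n.+1; rewrite sigmaE // in ch.
apply: chain_leq (leqnSn n) _.
by apply: eq_chain ch => i iltn; rewrite sigmaE.
Qed.

End Chains.

(** * Formulas *)

Lemma sat_iso (M N : Type) (G : structure M) (H : structure N) (f : M -> N)
    (g : N -> M) : cancel f g -> cancel g f ->
  (forall s x y, G s x y = H s (f x) (f y)) ->
  forall phi v, sat G phi v <-> sat H phi (f \o v).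
Proof.
move=> fK gK GH.
have upd v i a : f \o update v i a = update (f \o v) i (f a).
  by apply/funext => j; rewrite /update /=; case: eqP.
elim=> /= [s i j|i j|psi IH|psi IH|psi IH|i psi IH|i psi IH] v.
- by rewrite GH.
- by split=> [->|/(can_inj fK)].
- by rewrite IH.
- by split=> h n; apply/IH.
- by split=> -[n h]; exists n; apply/IH.
- split=> h a; last by apply/IH; rewrite upd.
  by have /IH := h (g a); rewrite upd gK.
- split=> -[a h]; last by exists (g a); apply/IH; rewrite upd gK.
  by exists (f a); rewrite -upd; apply/IH.
Qed.

Definition And2 f g := And (fun n => if n is 0 then f else g).
Definition Imp f g := Or (fun n => if n is 0 then Not f else g).
Definition Iff f g := And2 (Imp f g) (Imp g f).
Definition Cst (P : Prop) :=
  if `[< P >] then All 0 (Equal 0 0) else Ex 0 (Not (Equal 0 0)).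
Definition AndC (T : countType) (f : T -> formula) :=
  And (fun n => if @unpickle T n is Some t then f t else Cst True).
Definition OrC (T : countType) (f : T -> formula) :=
  Or (fun n => if @unpickle T n is Some t then f t else Cst False).

Section Sat.
Variables (M : Type) (G : structure M).
Implicit Types (f g : formula) (v w : nat -> M).

Lemma sat_and2 f g v : sat G (And2 f g) v <-> sat G f v /\ sat G g v.
Proof.
by split=> [h|[hf hg] [|n]] //; split; [exact: (h 0)|exact: (h 1)].
Qed.

Lemma sat_not f v : sat G (Not f) v <-> ~ sat G f v.
Proof. by []. Qed.

Lemma sat_all i f v : sat G (All i f) v <-> forall a, sat G f (update v i a).
Proof. by []. Qed.

Lemma sat_ex i f v : sat G (Ex i f) v <-> exists a, sat G f (update v i a).
Proof. by []. Qed.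

Lemma sat_imp f g v : sat G (Imp f g) v <-> (sat G f v -> sat G g v).
Proof.
split=> [[[|n] /= h] hf|h]; [by case: (h hf)|by []|].
by have [hf|nf] := pselect (sat G f v); [exists 1; exact: h|exists 0].
Qed.

Lemma sat_iff f g v : sat G (Iff f g) v <-> (sat G f v <-> sat G g v).
Proof. by rewrite /Iff sat_and2 !sat_imp. Qed.

Lemma sat_cst (P : Prop) v : sat G (Cst P) v <-> P.
Proof.
by rewrite /Cst; case: asboolP => h /=; split=> // -[a] /(_ erefl).
Qed.

Lemma sat_andC (T : countType) (f : T -> formula) v :
  sat G (AndC f) v <-> forall t, sat G (f t) v.
Proof.
rewrite (_ : sat G (AndC f) v = forall n,
    sat G (if @unpickle T n is Some t then f t else Cst True) v) //.
split=> [h t|h n]; first by have := h (pickle t); rewrite pickleK.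
by case: unpickle => [t|] //; rewrite sat_cst.
Qed.

Lemma sat_orC (T : countType) (f : T -> formula) v :
  sat G (OrC f) v <-> exists t, sat G (f t) v.
Proof.
rewrite (_ : sat G (OrC f) v = exists n,
    sat G (if @unpickle T n is Some t then f t else Cst False) v) //.
split=> [[n]|[t h]]; last by exists (pickle t); rewrite pickleK.
by case: unpickle => [t h|]; [exists t|rewrite sat_cst].
Qed.

End Sat.

Definition fv (S : set nat) phi := free_vars phi `<=` S.

Section FreeVars.
Implicit Types (f g : formula) (S : set nat).

Lemma fv_rel S s i j : S i -> S j -> fv S (Rel s i j).
Proof. by move=> Si Sj k [->|->]. Qed.

Lemma fv_equal S i j : S i -> S j -> fv S (Equal i j).
Proof. by move=> Si Sj k [->|->]. Qed.

Lemma fv_not S f : fv S f -> fv S (Not f).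
Proof. by []. Qed.

Lemma fv_all S i f : fv (S `|` [set i]) f -> fv S (All i f).
Proof. by move=> h k [fk ki]; case: (h k fk) => // /ki. Qed.

Lemma fv_ex S i f : fv (S `|` [set i]) f -> fv S (Ex i f).
Proof. by move=> h k [fk ki]; case: (h k fk) => // /ki. Qed.

Lemma fv_and S (f : nat -> formula) : (forall n, fv S (f n)) -> fv S (And f).
Proof. by move=> hf k [n _ /hf]. Qed.

Lemma fv_and2 S f g : fv S f -> fv S g -> fv S (And2 f g).
Proof. by move=> hf hg k [[|n] _ /=]; [exact: hf|exact: hg]. Qed.

Lemma fv_imp S f g : fv S f -> fv S g -> fv S (Imp f g).
Proof. by move=> hf hg k [[|n] _ /=]; [exact: hf|exact: hg]. Qed.

Lemma fv_iff S f g : fv S f -> fv S g -> fv S (Iff f g).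
Proof. by move=> hf hg; apply: fv_and2; exact: fv_imp. Qed.

Lemma fv_cst S (P : Prop) : fv S (Cst P).
Proof. by rewrite /Cst; case: asboolP => _ k [] /= []. Qed.

Lemma fv_andC S (T : countType) (f : T -> formula) :
  (forall t, fv S (f t)) -> fv S (AndC f).
Proof. by move=> hf k [n _]; case: unpickle => [t /hf|/fv_cst]; apply. Qed.

Lemma fv_orC S (T : countType) (f : T -> formula) :
  (forall t, fv S (f t)) -> fv S (OrC f).
Proof. by move=> hf k [n _]; case: unpickle => [t /hf|/fv_cst]; apply. Qed.

Lemma fv_sub S S' f : S `<=` S' -> fv S f -> fv S' f.
Proof. by move=> SS' h k /h /SS'. Qed.

Lemma sentence_fv f : sentence f <-> fv set0 f.
Proof. by rewrite /sentence /fv subset0. Qed.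

End FreeVars.

(** Complements become negations and countable unions become countable disjunctions. *)
Lemma borel_formula (gamma : nat -> formula) (E : set (nat -> bool)) :
  (forall n, sentence (gamma n)) -> borel E ->
  exists2 eps, sentence eps & forall (G : structure nat) v,
    sat G eps v <-> E (fun n => `[< sat G (gamma n) v >]).
Proof.
move=> sg; elim=> [n|{}E _ [f sf fE]|{}E _ IH].
- by exists (gamma n) => // G v; rewrite /= asboolE.
- by exists (Not f) => // G v /=; rewrite fE.
- have /choice[f fP] n : exists f, sentence f /\ forall (G : structure nat) v,
      sat G f v <-> E n (fun n => `[< sat G (gamma n) v >]).
    by have [f] := IH n; exists f.
  exists (Or f); first by rewrite /sentence /= bigcup0 // => n _; have [] := fP n.
  by move=> G v; split=> [[n] /(fP n).2|[n _] /(fP n).2]; exists n.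
Qed.

(* Variables 0, 1 and 2 stand for vertices, 3 is bound in Twin, and the twins
   of a vertex are 4, 5, ... *)
Fixpoint exs n phi := if n is n'.+1 then Ex (4 + n') (exs n' phi) else phi.

Lemma sat_exs (M : Type) (G : structure M) n phi v :
  sat G (exs n phi) v <->
  exists2 w, (forall i, ~~ (4 <= i < 4 + n) -> w i = v i) & sat G phi w.
Proof.
elim: n v => [|n IH] v /=.
  split=> [h|[w wv]]; first by exists v.
  suff -> : w = v by [].
  by apply/funext => i; apply: wv; lia.
split=> [[a /IH[w wv h]]|[w wv h]].
  exists w => // i iN; rewrite wv; last by lia.
  by rewrite /update; case: eqP => //; lia.
exists (w (4 + n)); apply/IH; exists w => // i iN; rewrite /update.
by case: eqP => [->//|ne]; apply: wv; lia.
Qed.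

Lemma fv_exs S n phi :
  fv (S `|` [set i | 4 <= i < 4 + n]) phi -> fv S (exs n phi).
Proof.
elim: n phi S => [|n IH] phi S h /=.
  by apply: fv_sub h => i [//|]; rewrite /=; lia.
apply: fv_ex; apply: IH; apply: fv_sub h => i /= [Si|iN]; first by left; left.
have [->|ne] := eqVneq i (4 + n); first by left; right.
by right; move/eqP: ne; lia.
Qed.

Definition Twin i j := All 3 (Iff (Rel symP i 3) (Rel symP j 3)).

(** In a marked tree the twins of a leaf are the leaves of its node, whereas a node is its own only
    twin; counting twins thus counts leaves. *)
Definition twin (M : Type) (G : structure M) x y :=
  forall z, G symP x z <-> G symP y z.

Lemma sat_twin (M : Type) (G : structure M) i j v : i != 3 -> j != 3 ->
  sat G (Twin i j) v <-> twin G (v i) (v j).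
Proof.
move=> i3 j3.
have key a : sat G (Iff (Rel symP i 3) (Rel symP j 3)) (update v 3 a) <->
    (G symP (v i) a <-> G symP (v j) a).
  by rewrite sat_iff /= /update (negbTE i3) (negbTE j3).
by split=> h a; have := h a; rewrite /= => /key.
Qed.

Definition at_least_twins n k := exs n (And2
  (AndC (fun i : 'I_n => Twin k (4 + i)))
  (AndC (fun p : 'I_n * 'I_n =>
    if p.1 == p.2 then Cst True else Not (Equal (4 + p.1) (4 + p.2))))).

Lemma sat_at_least_twins (M : Type) (G : structure M) n k v : k < 3 ->
  sat G (at_least_twins n k) v <->
  exists f : 'I_n -> M, injective f /\ forall i, twin G (v k) (f i).
Proof.
move=> k3; rewrite sat_exs; split=> [[w wv]|[f [f_inj fP]]].
  rewrite sat_and2 !sat_andC => -[wt wi]; exists (fun i => w (4 + i)); split.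
    move=> i j wij; apply/eqP; apply: contraT => ij.
    by have := wi (i, j); rewrite /= (negbTE ij) /=; case.
  by move=> i; have := wt i; rewrite sat_twin ?(ltn_eqF k3) // wv //; lia.
pose w j := if insub (j - 4) is Some i then if 4 <= j then f i else v j else v j.
have wE (i : 'I_n) : w (4 + i) = f i.
  by rewrite /w (_ : 4 + i - 4 = i); [rewrite valK|lia].
have wv j : ~~ (4 <= j < 4 + n) -> w j = v j.
  rewrite /w; case: insubP => // i jn _; case: ifP => //; lia.
exists w => //; rewrite sat_and2 !sat_andC; split=> [i|[i j]].
  by rewrite sat_twin ?(ltn_eqF k3) // wE wv; [exact: fP|lia].
case: eqP => [_|/= ij]; first by rewrite sat_cst.
by rewrite /= !wE => /f_inj.
Qed.

Lemma fv_at_least_twins n k : fv [set k] (at_least_twins n k).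
Proof.
apply: fv_exs; apply: fv_and2; apply: fv_andC.
- move=> i; apply: fv_all; apply: fv_iff; apply: fv_rel; try by [right|left; left].
  by left; right; rewrite /=; have := ltn_ord i; lia.
- move=> [i j]; case: ifP => _; first exact: fv_cst.
  by apply: fv_not; apply: fv_equal; right => /=;
    [have := ltn_ord i|have := ltn_ord j]; lia.
Qed.

Definition exactly_twins n k :=
  And2 (at_least_twins n k) (Not (at_least_twins n.+1 k)).

(** * Types of vertices and their definability *)

Section Types.
Variable L : countType.
Implicit Types (a b : seq L) (M : pred (seq L)).

(** A vertex up to the choice among the loopless leaves of its node. *)
Definition vtype : countType := (seq L * 'I_3)%type.

Definition vtype_of M (x : seq L * nat) : vtype := (x.1, inord (leaf_class M x)).

(** With all first leaves looped, class 1 always means looped. The relations between types are then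
    the same for every marking, which only decides which types of class 1 are realised. *)
Definition full_tree s (t t' : vtype) : bool :=
  raw_tree xpredT s (t.1, val t.2) (t'.1, val t'.2).

Lemma vtype_of2 M x : val (vtype_of M x).2 = leaf_class M x.
Proof. by rewrite /vtype_of /leaf_class /=; do 2?case: ifP => _; rewrite inordK. Qed.

Lemma full_treeE M s x y :
  raw_tree M s x y = full_tree s (vtype_of M x) (vtype_of M y).
Proof.
rewrite /full_tree !vtype_of2; apply: (@raw_tree_map _ _ _ id) => //.
by split=> // a l; exists l.
Qed.

(** A leaf is recognised by its number of twins and its loop, a node as the neighbour of one of its
    leaves. *)
Definition type_formula (t : vtype) k :=
  let leaf k := exactly_twins (leaf_count t.1) k in
  match val t.2 with
  | 0 => Ex 2 (And2 (Rel symP k 2) (leaf 2))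
  | 1 => And2 (leaf k) (Rel symQ k k)
  | _ => And2 (leaf k) (Not (Rel symQ k k))
  end.

Lemma fv_type_formula t k : fv [set k] (type_formula t k).
Proof.
have leaf_fv j : fv [set j] (exactly_twins (leaf_count t.1) j).
  by apply: fv_and2; last apply: fv_not; exact: fv_at_least_twins.
rewrite /type_formula; case: (val t.2) => [|[|n]].
- apply: fv_ex; apply: fv_and2; first by apply: fv_rel; [left|right].
  by apply: fv_sub (leaf_fv 2) => i; right.
- by apply: fv_and2 (leaf_fv k) _; exact: fv_rel.
- by apply: fv_and2 (leaf_fv k) _; apply: fv_not; exact: fv_rel.
Qed.

Lemma marked_tree_leaf_nbh M a i (z : vertex L) :
  raw_tree M symP (a, i.+1) (val z) = (val z == (a, 0)).
Proof.
apply/idP/eqP => [/orP[/par_fst0 //|]|->]; last first.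
  by apply/orP; right; exact: par_leaf.
by move: (val z) => -[b j] /[dup] /par_fst0 /= -> /par_leafP ->.
Qed.

Lemma twin_leaf M a i (x y : vertex L) : val x = (a, i.+1) ->
  twin (marked_tree M) x y <-> (val y).1 = a /\ (val y).2 != 0.
Proof.
move=> xE; rewrite /twin /marked_tree xE; split=> [h|].
  have := h (node a); rewrite marked_tree_leaf_nbh eqxx => -[/(_ isT) + _].
  case e: (val y) => [b [|j]]; last first.
    by rewrite marked_tree_leaf_nbh /= => /eqP[->].
  have := h (leaf1 b); rewrite marked_tree_leaf_nbh /= e xpair_eqE andbF.
  by move=> -[_]; rewrite par_leaf => /(_ isT).
case e: (val y) => [b [|j]] /= [bE // _] z.
by have := marked_tree_leaf_nbh M; rewrite /= => nbh; rewrite !nbh bE.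
Qed.

Lemma twin_node M a (x y : vertex L) : val x = (a, 0) ->
  twin (marked_tree M) x y -> y = x.
Proof.
move=> xE h; apply: val_inj; have := h (leaf1 a).
rewrite /marked_tree xE /= par_leaf => -[/(_ isT) + _].
by move: (sval y) => -[b j] /orP[/[dup] /par_fst0 /= -> /par_leafP ->|/par_fst0].
Qed.

(** A node has a single twin, too few since [leaf_count a] is at least 2. A leaf of [b] has
    [leaf_count b] twins, itself included, and this number determines [b]. *)
Lemma sat_exactly_twins M a k v : k < 3 ->
  sat (marked_tree M) (exactly_twins (leaf_count a) k) v <->
  (val (v k)).1 = a /\ (val (v k)).2 != 0.
Proof.
move=> k3; rewrite sat_and2 sat_not !sat_at_least_twins //.
case e: (val (v k)) => [b [|i]] /=.
  split=> [[[f [f_inj fP]] _]|[//]].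
  have fE i : f i = v k by exact: (twin_node e (fP i)).
  by have := f_inj ord0 ord_max; rewrite !fE => /(_ erefl)/(congr1 val).
have twins n : (exists f : 'I_n -> vertex L, injective f /\
    forall i, twin (marked_tree M) (v k) (f i)) <-> n <= leaf_count b.
  split=> [[f [f_inj fP]]|nb].
    have fb j : (val (f j)).1 = b /\ (val (f j)).2 != 0 by apply/(twin_leaf _ _ e).
    have lt j : (val (f j)).2.-1 < leaf_count b.
      have := valP (f j); have [-> ne] := fb j; lia.
    have inj : injective (fun j => Ordinal (lt j)).
      move=> j j' /(congr1 val)/= h; apply: f_inj; apply: val_inj.
      have [b1 n1] := fb j; have [b2 n2] := fb j'.
      rewrite [LHS]surjective_pairing [RHS]surjective_pairing b1 b2.
      by congr pair; move: h n1 n2 => /=; lia.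
    by have := leq_card _ inj; rewrite !card_ord.
  have lt (j : 'I_n) : (b, j.+1).2 <= leaf_count (b, j.+1).1.
    exact: leq_trans (ltn_ord j) nb.
  exists (fun j : 'I_n => exist _ (b, j.+1) (lt j)); split.
    by move=> j j' /(congr1 val)[] ?; apply: val_inj.
  by move=> j; apply/(twin_leaf _ _ e).
rewrite !twins; split=> [[ab]|[-> _]]; last by rewrite leqnn ltnn.
move=> /negP; rewrite -leqNgt => ba; split=> //; apply: (pcan_inj pickleK).
by move: ab ba; rewrite /leaf_count; lia.
Qed.

Lemma sat_type_formula M t k v : k < 2 ->
  sat (marked_tree M) (type_formula t k) v <-> vtype_of M (val (v k)) = t.
Proof.
move=> k2; case: t => [a j].
have -> : (vtype_of M (val (v k)) = (a, j)) <->
    (val (v k)).1 = a /\ val (vtype_of M (val (v k))).2 = j.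
  split=> [e|[ea ej]]; first by split; [exact: (congr1 fst e)|rewrite e].
  exact: (congr2 pair ea (val_inj ej)).
rewrite vtype_of2 /leaf_class /type_formula.
have Qmark : sat (marked_tree M) (Rel symQ k k) v <-> mark M (val (v k)).
  by rewrite /= /marked_tree /= ancxx eqxx.
have leafE := sat_exactly_twins M a; have and2E := @sat_and2 _ (marked_tree M).
move: And2 (exactly_twins (leaf_count a)) and2E leafE => and2 leaf and2E leafE.
case: j => -[|[|[|//]]] ? /=.
- split=> [[y]|[va]].
    rewrite and2E leafE // /update /= (ltn_eqF k2) => -[vy [ya y0]].
    move: vy; case: (sval y) ya y0 => [b [|i]] //= -> _.
    by have := marked_tree_leaf_nbh M a i (v k); rewrite /= orbC => -> /eqP ->.
  case: ifP => [/eqP v0 _|_]; last by case: ifP.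
  exists (leaf1 a); rewrite and2E leafE // /update /= (ltn_eqF k2).
  split=> //; rewrite /marked_tree /= [val (v k)]surjective_pairing va v0.
  by rewrite par_leaf.
- rewrite and2E leafE ?(ltn_trans k2) // Qmark.
  rewrite /=; case: (sval (v k)) => b [|i] /=; first by split=> [[[]]|[]].
  rewrite /mark xpair_eqE andbF /=; case: ifP => [|].
    by split=> [[[-> _] _]|[-> _]].
  by split=> [[]|[]].
- rewrite and2E leafE ?(ltn_trans k2) // sat_not Qmark.
  rewrite /=; case: (sval (v k)) => b [|i] /=; first by split=> [[[]]|[]].
  rewrite /mark xpair_eqE andbF /=; case: ifP => [|].
    by split=> [[]|[]].
  by split=> [[[-> _] _]|[-> _]].
Qed.

End Types.

Lemma homomorphic_weakly (M N : Type) (G : structure M) (H : structure N) :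
  homomorphic G H -> weakly_homomorphic G H.
Proof. by move=> [h hh]; exists h => s x y /hh. Qed.

Lemma homomorphic_trans (M N P : Type) (G : structure M) (H : structure N)
    (J : structure P) : homomorphic G H -> homomorphic H J -> homomorphic G J.
Proof. by move=> [h hh] [k kk]; exists (k \o h) => s x y; rewrite hh kk. Qed.

Lemma weakly_homomorphic_trans (M N P : Type) (G : structure M) (H : structure N)
    (J : structure P) : weakly_homomorphic G H -> weakly_homomorphic H J ->
  weakly_homomorphic G J.
Proof. by move=> [h hh] [k kk]; exists (k \o h) => s x y /hh /kk. Qed.

(** * A sentence that determines marked trees up to homomorphisms both ways *)

Section TreeSentence.
Variables (L : countType) (beta : nat -> vertex L) (beta' : vertex L -> nat).
Hypotheses (betaK : cancel beta beta') (beta'K : cancel beta' beta).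
Implicit Types (a : seq L) (M : pred (seq L)) (t : vtype L).

Definition mark_formula a := Ex 0 (type_formula ((a, inord 1) : vtype L) 0).

Definition relation_formula s := AndC (fun p : vtype L * vtype L =>
  All 0 (All 1 (Imp (And2 (type_formula p.1 0) (type_formula p.2 1))
    (Iff (Rel s 0 1) (Cst (full_tree s p.1 p.2)))))).

Definition tree_sentence := And (fun n => match n with
  | 0 => All 0 (OrC (fun t => type_formula t 0))
  | 1 => AndC (fun p : vtype L * vtype L =>
      if p.1 == p.2 then Cst True
      else All 0 (Not (And2 (type_formula p.1 0) (type_formula p.2 0))))
  | 2 => AndC (fun t => if t.2 == inord 1 then Cst True else Ex 0 (type_formula t 0))
  | 3 => AndC (fun t => All 0 (All 1 (Imp (Equal 0 1)
      (Imp (type_formula t 0) (type_formula t 1)))))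
  | 4 => relation_formula symP
  | _ => relation_formula symQ
  end).

Lemma sentence_mark_formula a : sentence (mark_formula a).
Proof.
apply/sentence_fv; apply: fv_ex; apply: fv_sub (@fv_type_formula _ _ 0) => i ->.
by right.
Qed.

Lemma sentence_tree_sentence : sentence tree_sentence.
Proof.
have fv0 S t : S 0 -> fv S (type_formula t 0).
  by move=> S0; apply: fv_sub (@fv_type_formula _ _ 0) => i ->.
have fv1 S t : S 1 -> fv S (type_formula t 1).
  by move=> S1; apply: fv_sub (@fv_type_formula _ _ 1) => i ->.
have fvrel s : fv set0 (relation_formula s).
  apply: fv_andC => p; apply: fv_all; apply: fv_all.
  apply: fv_imp; first apply: fv_and2.
  - by apply: fv0; left; right.
  - by apply: fv1; right.
  - apply: fv_iff; last exact: fv_cst.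
    by apply: fv_rel; [left; right|right].
apply/sentence_fv; apply: fv_and; case=> [|[|[|[|[|n]]]]].
- by apply: fv_all; apply: fv_orC => t; apply: fv0; right.
- apply: fv_andC => p; case: ifP => _; first exact: fv_cst.
  by apply: fv_all; apply: fv_not; apply: fv_and2; apply: fv0; right.
- apply: fv_andC => t; case: ifP => _; first exact: fv_cst.
  by apply: fv_ex; apply: fv0; right.
- apply: fv_andC => t; do 2 apply: fv_all.
  apply: fv_imp; first by apply: fv_equal; [left; right|right].
  by apply: fv_imp; [apply: fv0; left; right|apply: fv1; right].
- exact: fvrel.
- exact: fvrel.
Qed.

Lemma sat_coded_tree M phi v :
  sat (coded_tree beta M) phi v <-> sat (marked_tree M) phi (beta \o v).
Proof. exact: (sat_iso betaK beta'K). Qed.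

Lemma sat_type_coded M t k v : k < 2 ->
  sat (coded_tree beta M) (type_formula t k) v <-> vtype_of M (val (beta (v k))) = t.
Proof. by move=> k2; rewrite sat_coded_tree sat_type_formula. Qed.

Lemma sat_mark_formula M a v :
  sat (coded_tree beta M) (mark_formula a) v <-> M a.
Proof.
split=> [/sat_ex[x]|Ma]; last first.
  apply/sat_ex; exists (beta' (leaf1 a)); apply/sat_type_coded => //.
  by rewrite /update /= beta'K /vtype_of /leaf_class /= Ma.
rewrite sat_type_coded // /update /=.
case: (sval (beta x)) => b i [/= ->] /(congr1 val).
by case: i => [|[|i]]; rewrite /leaf_class /=; [|case: (M a) => //|];
  rewrite !inordK.
Qed.

Lemma coded_tree_sentence M v : sat (coded_tree beta M) tree_sentence v.
Proof.
have full s : sat (coded_tree beta M) (relation_formula s) v.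
  apply/sat_andC => -[t t']; apply/sat_all => x; apply/sat_all => y; apply/sat_imp.
  rewrite sat_and2 !sat_type_coded // sat_iff sat_cst /update /= => -[<- <-].
  by rewrite -full_treeE.
case=> [|[|[|[|[|n]]]]]; [| | | |exact: full|exact: full].
- suff : sat (coded_tree beta M) (All 0 (OrC (fun t => type_formula t 0))) v by [].
  apply/sat_all => x; apply/sat_orC; exists (vtype_of M (val (beta x))).
  exact/sat_type_coded.
- apply/sat_andC => -[t t']; case: eqP => [_|tt']; first exact/sat_cst.
  apply/sat_all => x.
  by apply/sat_not; rewrite sat_and2 !sat_type_coded // => -[-> /tt'].
- apply/sat_andC => -[a i]; case: eqP => [_|/= i1]; first exact/sat_cst.
  suff [x xE] : exists x : vertex L, vtype_of M (val x) = (a, i).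
    apply/sat_ex; exists (beta' x); apply/sat_type_coded => //.
    by rewrite /update /= beta'K.
  case: i i1 => -[|[|[|//]]] lti i1.
  + by exists (node a); congr pair; apply: val_inj; rewrite /= inordK.
  + by case: i1; apply: val_inj; rewrite /= inordK.
  + by exists (leaf2 a); congr pair; apply: val_inj; rewrite /= inordK.
- apply/sat_andC => t; apply/sat_all => x; apply/sat_all => y; apply/sat_imp.
  move=> xy; have {}xy : x = y := xy.
  by apply/sat_imp; rewrite !sat_type_coded // xy.
Qed.

(** In both structures the relations depend only on the types of the vertices, and both realise the
    same types; hence any type-preserving map, in either direction, is a homomorphism. *)
Lemma tree_sentence_homomorphic (G : structure nat) M v :
  sat G tree_sentence v -> (forall a, M a <-> sat G (mark_formula a) v) ->
  homomorphic G (coded_tree beta M) /\ homomorphic (coded_tree beta M) G.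
Proof.
move=> Gs GM.
have sat0 t x y : sat G (type_formula t 0) (update v 0 x) ->
    sat G (type_formula t 0) (update (update v 0 x) 1 y).
  by apply: (sat_free _ _).1 => i /fv_type_formula ->.
have sat1 t x y : sat G (type_formula t 0) (update v 0 y) ->
    sat G (type_formula t 1) (update (update v 0 x) 1 y).
  move=> /(sat0 t y y) h.
  have /sat_andC/(_ t)/sat_all/(_ y)/sat_all/(_ y)/sat_imp/(_ erefl) := Gs 3.
  move=> /sat_imp/(_ h).
  by apply: (sat_free _ _).1 => i /fv_type_formula ->.
have /choice[h hE] x : exists t, sat G (type_formula t 0) (update v 0 x).
  by have /sat_all/(_ x)/sat_orC :
    sat G (All 0 (OrC (fun t => type_formula t 0))) v := Gs 0.
have huniq x t : sat G (type_formula t 0) (update v 0 x) -> h x = t.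
  move=> xt; have /sat_andC/(_ (h x, t)) := Gs 1; case: eqP => // _.
  move=> /sat_all/(_ x)/sat_not; rewrite sat_and2 => H.
  by case: H; split; [exact: hE|exact: xt].
have hsurj t : (t.2 == inord 1 -> M t.1) -> exists x, h x = t.
  move=> Mt; have [t1|t1] := eqVneq t.2 (inord 1); last first.
    have /sat_andC/(_ t) := Gs 2; rewrite (negbTE t1) => /sat_ex[x /huniq].
    by exists x.
  have /GM/sat_ex[x /huniq hx] : M t.1 by apply: Mt; rewrite t1.
  by exists x; rewrite hx -t1 -surjective_pairing.
have hmark x : (h x).2 = inord 1 -> M (h x).1.
  by move=> h1; apply/GM/sat_ex; exists x; rewrite -h1 -surjective_pairing.
have hfull s x y : G s x y = full_tree s (h x) (h y).
  have /sat_andC/(_ (h x, h y)) : sat G (relation_formula s) v.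
    by case: s; [exact: (Gs 4)|exact: (Gs 5)].
  move=> /sat_all/(_ x)/sat_all/(_ y)/sat_imp.
  rewrite sat_iff sat_cst sat_and2 => H.
  by have [H1 H2] := H (conj (sat0 _ _ _ (hE x)) (sat1 _ _ _ (hE y))); apply/idP/idP.
have hle x : (h x).2 <= leaf_count (h x).1.
  exact: leq_trans (leq_ord (h x).2) _.
pose hv x : vertex L := exist _ ((h x).1, val (h x).2) (hle x).
(* A vertex of class 1 in [G] witnesses a mark of [M], so its image, a first leaf, is looped and has
   class 1 as well. *)
have hvE x : vtype_of M (val (hv x)) = h x.
  rewrite /vtype_of /leaf_class [RHS]surjective_pairing /=; congr pair; apply: val_inj.
  have := hmark x; case: (h x).2 => -[|[|[|//]]] lti /= hM.
  - by rewrite inordK.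
  - by rewrite hM ?inordK //; apply: val_inj; rewrite /= inordK.
  - by rewrite inordK.
split.
  exists (beta' \o hv) => s x y.
  by rewrite /coded_tree /marked_tree /= !beta'K full_treeE !hvE hfull.
have /choice[g gE] j : exists x, h x = vtype_of M (val (beta j)).
  apply: hsurj; rewrite /vtype_of /leaf_class /=; case: ifP => _.
    by move=> /eqP/(congr1 val); rewrite /= !inordK.
  case: ifP => [/andP[_ ->] //|_].
  by move=> /eqP/(congr1 val); rewrite /= !inordK.
by exists g => s i j; rewrite hfull !gE -full_treeE.
Qed.

End TreeSentence.

(** * Reductions *)

Definition truth_code (gamma : nat -> formula) (G : omega_structure) n :=
  `[< sat G (gamma n) id >].

(** By the last hypothesis, bit [n] of [c] can be read off the marks on the nodes in [D n]; the
    sentence [gamma n] does so. Then [phi] says that the types behave as in a marked tree, that the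
    [c] read off lies in [E], and that the marks are those prescribed by this [c]. *)
Lemma family_sentence (L : countType) (beta : nat -> vertex L)
    (beta' : vertex L -> nat) (mk : (nat -> bool) -> pred (seq L))
    (D : nat -> pred (seq L)) (E : set (nat -> bool)) :
  cancel beta beta' -> cancel beta' beta ->
  (forall a, borel [set c | mk c a]) -> borel E ->
  (forall c n, (exists2 a, D n a & mk c a) <-> c n) ->
  exists phi gamma, [/\ sentence phi, forall n, sentence (gamma n),
    forall c, E c -> Mod phi (coded_tree beta (mk c)) &
    forall G, Mod phi G -> let c := truth_code gamma G in
      [/\ E c, homomorphic G (coded_tree beta (mk c)) &
          homomorphic (coded_tree beta (mk c)) G]].
Proof.
move=> betaK beta'K bmk bE Dmk.
pose gamma n := OrC (fun a => if D n a then mark_formula a else Cst False).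
have sgamma n : sentence (gamma n).
  apply/sentence_fv; apply: fv_orC => a; case: ifP => _; last exact: fv_cst.
  exact/sentence_fv/sentence_mark_formula.
have gammaE c v : (fun n => `[< sat (coded_tree beta (mk c)) (gamma n) v >]) = c.
  apply/funext => n; apply/asboolP/idP => [|/Dmk[a Da ca]]; rewrite /gamma sat_orC.
    move=> [a]; case: ifP => [Da|_]; last by rewrite sat_cst.
    by rewrite (sat_mark_formula betaK beta'K) => ca; apply/Dmk; exists a.
  by exists a; rewrite Da (sat_mark_formula betaK beta'K).
have [epsE sE EE] := borel_formula sgamma bE.
have /choice[eps epsP] a : exists eps, sentence eps /\ forall (G : structure nat) v,
    sat G eps v <-> mk (fun n => `[< sat G (gamma n) v >]) a.
  by have [f] := borel_formula sgamma (bmk a); exists f.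
pose marks := AndC (fun a => Iff (mark_formula a) (eps a)).
exists (And (fun n => match n with
  0 => tree_sentence L | 1 => epsE | _ => marks end)), gamma; split=> //.
- apply/sentence_fv; apply: fv_and => -[|[|n]]; apply/sentence_fv => //.
    exact: sentence_tree_sentence.
  apply/sentence_fv; apply: fv_andC => a; apply: fv_iff; apply/sentence_fv.
    exact: sentence_mark_formula.
  exact: (epsP a).1.
- move=> c Ec v [|[|n]]; first exact: coded_tree_sentence.
    by apply/EE; rewrite gammaE.
  suff : sat (coded_tree beta (mk c)) marks v by [].
  apply/sat_andC => a; apply/sat_iff.
  by rewrite (sat_mark_formula betaK beta'K) (epsP a).2 gammaE.
- move=> G Gphi c; have Ec : E c by apply/EE; exact: (Gphi id 1).
  have : sat G marks id := Gphi id 2.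
  rewrite /marks sat_andC => Gmarks.
  have Gt : sat G (tree_sentence L) id := Gphi id 0.
  have GM a : mk c a <-> sat G (mark_formula a) id.
    by have /sat_iff := Gmarks a; rewrite (epsP a).2 => ->.
  by have [] := tree_sentence_homomorphic beta'K Gt GM; split.
Qed.

Lemma measurable_fun_omega d (X : measurableType d) (A : set X)
    (f : X -> omega_structure) :
  (forall s i j, measurable [set x | f x s i j]) -> measurable_fun A f.
Proof.
move=> mf mA B mB; apply: measurableI => //.
apply: (mB (fun B => measurable (f @^-1` B))); split.
  split; first by rewrite preimage_set0; exact: measurable0.
    by move=> C mC; rewrite setTD preimage_setC; exact: measurableC.
  by move=> F mF; rewrite preimage_bigcup; exact: bigcup_measurable.
by move=> _ [s [i [j ->]]]; exact: mf.
Qed.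

Lemma measurable_bool_comp d (X : measurableType d) (b : X -> bool)
    (F : bool -> bool) :
  measurable [set x | b x] -> measurable [set x | F (b x)].
Proof.
move=> mb; case Ft: (F true); case Ff: (F false).
- rewrite (_ : mkset _ = setT) //.
  by apply/seteqP; split=> x //= _; case: (b x); rewrite ?Ft ?Ff.
- rewrite (_ : mkset _ = [set x | b x]) //.
  by apply/seteqP; split=> x /=; case: (b x); rewrite ?Ft ?Ff.
- rewrite (_ : mkset _ = ~` [set x | b x]); first exact: measurableC.
  by apply/seteqP; split=> x /=; case: (b x); rewrite ?Ft ?Ff.
- rewrite (_ : mkset _ = set0) //.
  by apply/seteqP; split=> x //=; case: (b x); rewrite ?Ft ?Ff.
Qed.

Lemma measurable_decode d (X : measurableType d) (A : set omega_structure)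
    (c : omega_structure -> nat -> bool) (r : (nat -> bool) -> X) :
  (forall n, measurable [set G | c G n]) ->
  (forall B, measurable B -> borel (r @^-1` B)) -> measurable_fun A (r \o c).
Proof.
move=> mc br mA B /br bB; apply: measurableI => //.
exact: (measurable_borel mc bB).
Qed.

Notation tletter := (option letter : countType).

Lemma borel_marked Phi p : borel [set c | `[< marked Phi c p >]].
Proof.
apply: (@borel_depends (size p)) => c c' cc' /asboolP h; apply/asboolP.
exact: marked_depends h.
Qed.

(** A chain without links is marked iff its label is an initial segment of [c], so these marks
    reveal every bit of [c]. *)
Lemma marked_zero_word Phi c n :
  (exists2 p, (exists u, [/\ size u = n.+1, nth false u n &
      p = word (nseq n.+1 [::]) u]) & marked Phi c p) <-> c n.
Proof.
split=> [[_ [u [su un ->]]]|cn].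
  rewrite marked_word ?size_nseq // => h; have {}h : chain Phi 0 (size u)
    (nth false u) (nth [::] (nseq n.+1 [::])) c := h.
  by have [|_ <-] := h n; rewrite ?su.
exists (word (nseq n.+1 [::]) (mkseq c n.+1)).
  by exists (mkseq c n.+1); rewrite size_mkseq nth_mkseq.
rewrite marked_word ?size_nseq ?size_mkseq //.
suff : chain Phi 0 n.+1 (nth false (mkseq c n.+1)) (nth [::] (nseq n.+1 [::])) c by [].
by move=> i iltn; rewrite nth_nseq iltn nth_mkseq.
Qed.

(** [f x] is the tree of the code [e x], and [g] reads a code off a structure and decodes it. As [R]
    yields homomorphisms and is implied by weak ones, both versions of the theorem follow from the
    same [f] and [g]. *)
Lemma analytic_quasi_order_trees (K : realType) d (X : measurableType d)
    (A : set X) (R : X -> X -> Prop) : analytic_quasi_order K A R ->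
  exists phi (f : X -> omega_structure) (g : omega_structure -> X),
  [/\ sentence phi, measurable_fun A f & measurable_fun (Mod phi) g] /\
  [/\ forall x, A x -> OCT (f x) /\ Mod phi (f x),
      forall x y, A x -> A y -> R x y -> homomorphic (f x) (f y),
      forall x y, A x -> A y -> weakly_homomorphic (f x) (f y) -> R x y &
      forall G, Mod phi G ->
        [/\ A (g G), homomorphic G (f (g G)) & homomorphic (f (g G)) G]].
Proof.
move=> [sX mA [Rrefl Rtrans] aR].
have [e [r [me br rK]]] := standard_borel_retract sX.
have [Phi cPhi PhiE] := analytic_relation me aR.
have [beta [beta' [betaK beta'K]]] : exists (b : nat -> vertex tletter) b',
    cancel b b' /\ cancel b' b.
  apply: (@countable_enumeration _ (fun n => node (nseq n (None : tletter)))).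
  by move=> m n /(congr1 (fun x => size (val x).1)); rewrite !size_nseq.
pose mk c : pred (seq tletter) := fun p => `[< marked Phi c p >].
pose D n : pred (seq tletter) := fun p => `[< exists u, [/\ size u = n.+1,
  nth false u n & p = word (nseq n.+1 [::]) u] >].
have Dmk c n : (exists2 p, D n p & mk c p) <-> c n.
  rewrite -(marked_zero_word Phi); by split=> -[p ? ?];
    exists p; apply/asboolP.
(* The image of [A] under [e], which is Borel because [r] is a Borel left inverse of [e]. *)
pose E := [set c | A (r c) /\ e (r c) = c].
have bE : borel E.
  have er n : borel [set c | e (r c) n] := br _ (me n).
  apply: (@borelI (r @^-1` A) [set c | e (r c) = c]); first exact: br.
  rewrite (_ : mkset _ = [set c | forall n, e (r c) n <-> c n]).
    by apply: borel_forall => n; apply: borel_iff; [exact: er|exact: borel_bit].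
  apply/seteqP; split=> c /= => [-> //|h].
  by apply/funext => n; have [h1 h2] := h n; apply/idP/idP.
have [phi [gamma [sphi sgamma Ephi phiE]]] :=
  family_sentence betaK beta'K (borel_marked Phi) bE Dmk.
have eE x : A x -> E (e x) by move=> Ax; rewrite /E /= rK.
have rel x y : A x -> A y -> related Phi (e x) (e y) <-> R x y.
  move=> Ax Ay; rewrite /related PhiE; split=> [|Rxy]; last by exists x, y.
  by move=> [x' [y' [_ _ Rxy /(can_inj rK) -> /(can_inj rK) ->]]].
have rel_trans a b c : related Phi a b -> related Phi b c -> related Phi a c.
  rewrite /related => /PhiE[x [y [Ax Ay Rxy -> ->]]].
  move=> /PhiE[y' [z [_ Az Ryz /(can_inj rK) yy' ->]]].
  by apply/rel => //; apply: (Rtrans x y z) => //; rewrite yy'.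
exists phi, (fun x => coded_tree beta (mk (e x))), (r \o truth_code gamma).
split; split=> //.
- apply: measurable_fun_omega => s i j.
  (* The marking enters the relation between two given vertices only through the mark at the node of
     the first one. *)
  pose p := (val (beta i)).1; pose b x := mk (e x) p.
  have mb : measurable [set x | b x] := measurable_borel me (borel_marked Phi p).
  rewrite (_ : mkset _ =
      [set x | marked_tree (fun=> b x) s (beta i) (beta j)]) //.
  exact: (measurable_bool_comp
    (fun t => marked_tree (fun=> t) s (beta i) (beta j)) mb).
- apply: measurable_decode br => n.
  rewrite (_ : mkset _ = [set G : omega_structure | sat G (gamma n) id]).
    exact: measurable_sat.
  by apply/seteqP; split=> G /asboolP.
- by move=> x Ax; split; [exact: coded_tree_OCT|exact/Ephi/eE].
- move=> x y Ax Ay /rel-/(_ Ax Ay) xy; apply: homomorphic_coded_tree => //.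
  have [k [tk ik km]] := related_tree_map xy.
  apply: (tree_map_homomorphic tk ik) => p /asboolP /km ?; exact/asboolP.
- move=> x y Ax Ay /(weakly_homomorphic_coded_tree beta'K).
  move=> /weakly_homomorphic_tree_map[|k tk km]; first by apply/asboolP; left.
  have [|xy|] := tree_map_related cPhi rel_trans tk (a := e x) (b := e y).
  + by move=> p xp; apply/asboolP/km/asboolP.
  + by rewrite (can_inj rK xy); exact: Rrefl.
  + by move/rel; apply.
- move=> G /phiE[[Ar er] h1 h2]; split=> //=; by rewrite er.
Qed.

(** * The space of structures *)

Section MeasurableLogic.
Context d (X : measurableType d).

Lemma measurable_prop (P : Prop) : measurable [set _ : X | P].
Proof.
have [p|np] := pselect P.
  by rewrite (_ : mkset _ = setT) //; apply/seteqP; split.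
by rewrite (_ : mkset _ = set0) //; apply/seteqP; split.
Qed.

Lemma measurable_exists (T : countType) (P : T -> set X) :
  (forall t, measurable (P t)) -> measurable [set x | exists t, P t x].
Proof.
move=> mP; rewrite (_ : mkset _ = \bigcup_t P t).
  by apply: countable_bigcupT_measurable => //; exact/countableP.
by apply/seteqP; split=> x [t]; [|move=> _]; exists t.
Qed.

Lemma measurable_forall (T : countType) (P : T -> set X) :
  (forall t, measurable (P t)) -> measurable [set x | forall t, P t x].
Proof.
move=> mP; rewrite (_ : mkset _ = ~` [set x | exists t, (~` P t) x]).
  by apply: measurableC; apply: measurable_exists => t; exact: measurableC.
apply/seteqP; split=> x /= h; first by move=> [t]; apply; exact: h.
by move=> t; apply: contrapT => nP; apply: h; exists t.
Qed.

Lemma measurable_imply (P Q : set X) :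
  measurable P -> measurable Q -> measurable [set x | P x -> Q x].
Proof.
move=> mP mQ; rewrite (_ : mkset _ = ~` P `|` Q).
  exact/measurableU/mQ/measurableC.
apply/seteqP; split=> x /=; last by case.
by have [Px /(_ Px)|] := pselect (P x); [right|left].
Qed.

End MeasurableLogic.

Definition triple (s : symbol) (i j : nat) : bool * nat * nat :=
  (if s is symP then true else false, i, j).

Definition holds (G : structure nat) (t : bool * nat * nat) : bool :=
  G (if t.1.1 then symP else symQ) t.1.2 t.2.

Definition bit (G : structure nat) n : bool :=
  if @unpickle (bool * nat * nat)%type n is Some t then holds G t else false.

(** These finite structures form the countable dense set. *)
Definition of_triples (l : seq (bool * nat * nat)) : structure nat :=
  fun s i j => triple s i j \in l.

Lemma bit_pickle G s i j : bit G (pickle (triple s i j)) = G s i j.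
Proof. by rewrite /bit pickleK; case: s. Qed.

Lemma holds_of_triples l t : holds (of_triples l) t = (t \in l).
Proof. by case: t => -[[] i] j. Qed.

Lemma bit_of_triples G n :
  exists l, forall i, i <= n -> bit (of_triples l) i = bit G i.
Proof.
exists [seq t <- pmap unpickle (iota 0 n.+1) | holds G t] => i ilen.
rewrite /bit; case e: unpickle => [t|] //.
rewrite holds_of_triples mem_filter andb_idr // => _.
rewrite mem_pmap; apply/mapP; exists i => //.
by rewrite mem_iota add0n ltnS ilen.
Qed.

Lemma bit_inj G H : bit G =1 bit H -> G = H.
Proof.
move=> GH; apply/funext => s; apply/funext => i; apply/funext => j.
by rewrite -!bit_pickle.
Qed.

Definition structure_space (K : realType) : Type := structure nat.

HB.instance Definition _ K := Pointed.copy (structure_space K) (structure nat).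

Section Space.
Variable K : realType.
Local Open Scope ring_scope.
Implicit Types G H J : structure_space K.

Definition dist (G H : structure_space K) : K :=
  if pselect (exists n, bit G n != bit H n) is left ex then
    (ex_minn ex).+1%:R^-1 else 0.

Lemma dist_lt G H n : (dist G H < n.+1%:R^-1) =
  `[< forall i, (i <= n)%N -> bit G i = bit H i >].
Proof.
rewrite /dist; case: pselect => [ex|nex]; last first.
  rewrite invr_gt0 ltr0n; apply/esym/asboolP => i _; apply/eqP.
  by apply: contrapT => /negP ne; apply: nex; exists i.
case: ex_minnP => m nm mmin; rewrite ltf_pV2 ?posrE ?ltr0n // ltr_nat ltnS.
apply/idP/asboolP => [nltm i ilen|h].
  by apply/eqP; apply: contraTT nltm => /mmin; lia.
by rewrite ltnNge; apply: contra nm => /h ->.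
Qed.

Lemma dist_le G H n : bit G n != bit H n -> n.+1%:R^-1 <= dist G H.
Proof.
move=> ne; rewrite leNgt dist_lt; apply: contra ne => /asboolP ->//.
Qed.

Lemma distxx G : dist G G = 0.
Proof.
by rewrite /dist; case: pselect => // ex; have [n] := ex; rewrite eqxx.
Qed.

Lemma dist_ge0 G H : 0 <= dist G H.
Proof. by rewrite /dist; case: pselect. Qed.

Lemma dist_eq0 G H : dist G H = 0 -> G = H.
Proof.
move=> d0; apply: bit_inj => n; apply/eqP; apply: contraT => /dist_le.
by rewrite d0 leNgt invr_gt0 ltr0n.
Qed.

Lemma dist_sym G H : dist G H = dist H G.
Proof.
suff le G' H' : dist G' H' <= dist H' G' by apply/eqP; rewrite eq_le !le.
move: G' H' => {}G {}H; rewrite /dist.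
case: (pselect (exists n, bit G n != bit H n)) => [ex|_]; last first.
  by case: pselect.
case: pselect => [ex'|[]]; last by have [n] := ex; exists n; rewrite eq_sym.
case: ex_minnP => m nm mmin; case: ex_minnP => m' nm' mmin'.
by rewrite lef_pV2 ?posrE ?ltr0n // ler_nat ltnS mmin' // eq_sym.
Qed.

Lemma dist_triangle H G J : dist G J <= dist G H + dist H J.
Proof.
rewrite {1}/dist; case: pselect => [ex|_]; last by rewrite addr_ge0 ?dist_ge0.
case: ex_minnP => m nm _.
have [GH|/dist_le GH] := eqVneq (bit G m) (bit H m); last first.
  by apply: le_trans GH _; rewrite lerDl dist_ge0.
by rewrite GH in nm; apply: le_trans (dist_le nm) _; rewrite lerDr dist_ge0.
Qed.

HB.instance Definition _ := isMetric.Build K (structure_space K) distxx dist_eq0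
  dist_sym dist_triangle.

Lemma ball_structureE G n :
  ball G n.+1%:R^-1 = [set H | forall i, (i <= n)%N -> bit G i = bit H i].
Proof.
rewrite ballEmdist; apply/seteqP; split=> H /=.
  by rewrite [mdist _ _]/(dist G H) dist_lt => /asboolP.
by rewrite [mdist _ _]/(dist G H) dist_lt => h; apply/asboolP.
Qed.

Lemma nbhs_structureP G (A : set (structure_space K)) : nbhs G A <->
  exists n, forall H, (forall i, (i <= n)%N -> bit G i = bit H i) -> A H.
Proof.
split=> [/nbhs_ballP[x /= x0 xA]|[n nA]].
  have [n] := ltr_add_invr x0; rewrite add0r => nx; exists n => H GH; apply: xA.
  by apply: (le_ball (ltW nx)); rewrite ball_structureE.
apply/nbhs_ballP; exists n.+1%:R^-1; first by rewrite /= invr_gt0 ltr0n.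
by rewrite ball_structureE.
Qed.

Lemma polish_structure_space : polish (structure_space K).
Proof.
split=> [F FF Fc|].
  have /choice[x Fx] n : exists x, F [set y : structure_space K |
      forall i, (i <= n)%N -> bit x i = bit y i].
    have n0 : 0 < n.+1%:R^-1 :> K by rewrite invr_gt0 ltr0n.
    have [x] := (@cauchyP _ _ F _).1 Fc _ n0.
    by rewrite ball_structureE; exists x.
  (* Each value is copied from the centre of a ball so small that all its members share this bit. *)
  pose y : structure_space K := fun s i j => x (pickle (triple s i j)) s i j.
  have Fy s i j : F [set z : structure_space K | z s i j = y s i j].
    apply: filterS (Fx (pickle (triple s i j))) => z /= h.
    by rewrite /y -!bit_pickle h.
  have Fb i : F [set z : structure_space K | bit y i = bit z i].
    rewrite /bit; case: unpickle => [[[b p] q]|]; last first.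
      by apply: filterS filterT.
    apply: filterS (Fy (if b then symP else symQ) p q) => z /=.
    by rewrite /holds /= => ->.
  exists y => A /nbhs_structureP[n nA]; apply: (filterS nA).
  elim: n {nA} => [|n IH].
    by apply: filterS (Fb 0%N) => z /= h i; rewrite leqn0 => /eqP ->.
  apply: filterS (filterI IH (Fb n.+1)) => z /= [h hn] i.
  by rewrite leq_eqVlt => /orP[/eqP -> //|]; exact: h.
exists [set of_triples l | l in [set: seq (bool * nat * nat)]].
  by apply: sub_countable (card_image_le _ _) _; exact: countableP.
move=> U [G UG] oU; have /nbhs_structureP[n nU] : nbhs G U by exact: open_nbhs_nbhs.
have [l lG] := bit_of_triples G n.
by exists (of_triples l); split; [apply: nU => i /lG ->|exists l].
Qed.

(** An open set is the union of the balls around finite structures that it contains. There are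
    countably many of these, and each is given by finitely many bits. *)
Lemma open_structureP (B : set (structure nat)) :
  <<s @open (structure_space K) >> B <-> <<s cylinders >> B.
Proof.
split.
  apply: smallest_sub; first exact: smallest_sigma_algebra.
  move=> U oU.
  have mbit i : measurable [set H : omega_structure | bit H i].
    rewrite /bit; case: unpickle => [t|]; last first.
      by rewrite (_ : mkset _ = set0) //; apply/seteqP; split.
    by apply: sub_sigma_algebra; exists (if t.1.1 then symP else symQ), t.1.2, t.2.
  pose near G n := [set H : omega_structure |
    forall i, (i <= n)%N -> bit G i = bit H i].
  have mnear G n : measurable (near G n).
    rewrite (_ : near G n = \bigcap_(i in [set i | (i <= n)%N])
      [set H : omega_structure | bit G i = bit H i]).
      apply: bigcap_measurable => [|i _]; first by exists 0%N.
      rewrite (_ : mkset _ = [set H | bit G i == bit H i]).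
        exact: (measurable_bool_comp (fun b => bit G i == b) (mbit i)).
      by apply/seteqP; split=> H /= /eqP.
    by apply/seteqP; split=> H h i; exact: h.
  pose S := [set G : omega_structure | exists p : seq (bool * nat * nat) * nat,
    near (of_triples p.1) p.2 `<=` U /\ near (of_triples p.1) p.2 G].
  have mS : measurable S.
    by apply: measurable_exists => p; apply: measurableI;
      [exact: measurable_prop|exact: mnear].
  suff -> : U = S by exact: mS.
  apply/seteqP; split=> G; last by move=> [p [pU]]; exact: pU.
  move=> UG; have /nbhs_structureP[n nU] : nbhs G U by exact: open_nbhs_nbhs.
  have [l lG] := bit_of_triples G n; exists (l, n); split=> [H lH|i /lG //].
  by apply: nU => i ilen; rewrite -lG // lH.
apply: smallest_sub; first exact: smallest_sigma_algebra.
move=> _ [s [i [j ->]]]; apply: sub_sigma_algebra; rewrite openE => G Gs.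
apply/nbhs_structureP; exists (pickle (triple s i j)) => H GH /=.
by rewrite -bit_pickle -GH // bit_pickle.
Qed.

End Space.

Lemma standard_borel_omega_structure (K : realType) :
  standard_borel K omega_structure.
Proof.
exists (structure_space K), id; split.
- exact: polish_structure_space.
- by exists id.
- by move=> B; rewrite open_structureP.
Qed.

(** * The class OCT *)

Lemma measurable_edge s i j : measurable [set G : omega_structure | G s i j].
Proof. by apply: sub_sigma_algebra; exists s, i, j. Qed.

Lemma measurable_path x p :
  measurable [set G : omega_structure | path (G symP) x p].
Proof.
elim: p x => [|y p IH] x /=; first exact: measurable_prop.
rewrite (_ : mkset _ = [set G : omega_structure | G symP x y] `&`
    [set G : omega_structure | path (G symP) y p]).
  by apply: measurableI; [exact: measurable_edge|exact: IH].
by apply/seteqP; split=> G /=; move/andP.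
Qed.

(** All quantifiers range over numbers or finite sequences of numbers, hence over countable sets. *)
Lemma measurable_OCT : measurable OCT.
Proof.
rewrite (_ : OCT =
  [set G : omega_structure | forall x, ~ G symP x x] `&`
  [set G : omega_structure | forall x y, G symP x y -> G symP y x] `&`
  [set G : omega_structure | forall x y,
    exists p, path (G symP) x p /\ last x p = y] `&`
  [set G : omega_structure | forall c : seq nat,
    2 < size c -> ~ ucycle (G symP) c] `&`
  [set G : omega_structure | forall y x z,
    G symQ x y -> G symQ y z -> G symQ x z]).
  repeat apply: measurableI.
  - apply: (@measurable_forall _ _ _ 
      (fun x => ~` [set G : omega_structure | G symP x x])) => x.
    by apply: measurableC; exact: measurable_edge.
  - do 2 (apply: measurable_forall => ?).
    by apply: measurable_imply; exact: measurable_edge.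
  - do 2 (apply: measurable_forall => ?); apply: measurable_exists => p.
    by apply: measurableI; [exact: measurable_path|exact: measurable_prop].
  - apply: measurable_forall => c; apply: measurable_imply.
      exact: measurable_prop.
    apply: measurableC; rewrite /ucycle.
    apply: (@measurable_bool_comp _ _ (fun G : omega_structure => cycle (G symP) c)
      (fun b => b && uniq c)).
    case: c => [|x p]; first exact: (measurable_prop _ (is_true true)).
    exact: measurable_path.
  - do 3 (apply: measurable_forall => ?).
    by do 2 (apply: measurable_imply; first exact: measurable_edge);
      exact: measurable_edge.
apply/seteqP; split=> G.
  move=> [[irr sym con acy] tr]; split; last exact: tr.
  split; last exact: acy.
  split; last by move=> x y; have [p] := con x y; exists p.
  by split=> [x|x y]; rewrite ?irr // sym.
move=> [[[[irr sym] con] acy] tr]; split; last exact: tr.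
split=> [x|x y|x y|//]; first exact/negP/irr.
- by apply/idP/idP; exact: sym.
- by have [p []] := con x y; exists p.
Qed.

(* One structure codes two structures and the graph of a map between them. *)
Definition part k (Z : omega_structure) : omega_structure :=
  fun s i j => Z s (pickle (k : nat, i)) j.

Lemma measurable_part k : measurable_fun setT (part k).
Proof. by apply: measurable_fun_omega => s i j; exact: measurable_edge. Qed.

(** [strong] treats both kinds of homomorphism at once. The map is coded as a total relation [W]
    compatible with the structures, a Borel condition on [Z]; a choice function for [W] is a map of
    the desired kind. *)
Lemma analytic_OCT (K : realType) (strong : bool)
    (S : omega_structure -> omega_structure -> Prop) :
  (forall G H, S G H <-> exists h : nat -> nat, forall s x y,
     (G s x y -> H s (h x) (h y)) /\ (strong -> H s (h x) (h y) -> G s x y)) ->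
  analytic K [set p : omega_structure * omega_structure |
    [/\ OCT p.1, OCT p.2 & S p.1 p.2]].
Proof.
move=> SE.
pose W (Z : omega_structure) (i j : nat) := Z symP (pickle (2, i)) j.
pose compatible (Z : omega_structure) s (x y x' y' : nat) := W Z x x' -> W Z y y' ->
  (part 0 Z s x y -> part 1 Z s x' y') /\
  (strong -> part 1 Z s x' y' -> part 0 Z s x y).
exists _, omega_structure, ([set Z | OCT (part 0 Z)] `&` [set Z | OCT (part 1 Z)]
  `&` [set Z | forall i, exists j, W Z i j] `&`
  [set Z | forall s x y x' y', compatible Z s x y x' y']),
  (fun Z => (part 0 Z, part 1 Z)); split.
- exact: standard_borel_omega_structure.
- have mO k : measurable [set Z | OCT (part k Z)].
    rewrite -[X in measurable X]setTI.
    exact: (measurable_part k measurableT measurable_OCT).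
  apply: measurableI; first apply: measurableI; first exact: measurableI.
    apply: measurable_forall => i; apply: measurable_exists => j.
    exact: measurable_edge.
  rewrite (_ : mkset _ = [set Z | forall b : bool, forall x y x' y',
      compatible Z (if b then symP else symQ) x y x' y']).
    do 5 (apply: measurable_forall => ?).
    do 2 (apply: measurable_imply; first exact: measurable_edge).
    apply: measurableI; first by apply: measurable_imply; exact: measurable_edge.
    apply: measurable_imply; first exact: measurable_prop.
    by apply: measurable_imply; exact: measurable_edge.
  by apply/seteqP; split=> Z h; [move=> b|move=> s]; [exact: h|];
    case: s; [exact: (h true)|exact: (h false)].
- apply: (@measurable_funS _ _ _ _ setT) => //.
  by apply: measurable_fun_pair; exact: measurable_part.
- apply/seteqP; split; last first.
    move=> _ [Z [[[Z0 Z1] hW] Zc] <-]; split=> //=.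
    have [h hE] := choice hW; apply/SE; exists h => s x y.
    exact: (Zc s x y (h x) (h y)).
  move=> [G H] /= [ocG ocH /SE[h hh]].
    pose Z : omega_structure := fun s i j =>
      if @unpickle (nat * nat)%type i is Some (k, i') then
        match k with 0 => G s i' j | 1 => H s i' j | _ => j == h i' end
      else false.
    have Z0 : part 0 Z = G.
      by do 3 apply/funext => ?; rewrite /part /Z pickleK.
    have Z1 : part 1 Z = H.
      by do 3 apply/funext => ?; rewrite /part /Z pickleK.
    have ZW i j : W Z i j = (j == h i) by rewrite /W /Z pickleK.
    exists Z; last by rewrite Z0 Z1.
    split; last first.
      by move=> s x y x' y'; rewrite /compatible !ZW Z0 Z1 => /eqP -> /eqP ->.
    split; first by split; rewrite /= ?Z0 ?Z1.
    by move=> i; exists (h i); rewrite ZW.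
Qed.

Theorem theorem3p6 (K : realType) :
  (complete_analytic_quasi_order K OCT (@homomorphic nat nat) /\
   complete_analytic_quasi_order K OCT (@weakly_homomorphic nat nat)) /\
  (forall (d : measure_display) (X : measurableType d) (A : set X)
     (R : X -> X -> Prop),
     analytic_quasi_order K A R ->
     (exists phi : formula, sentence phi /\
        borel_equivalent A R (Mod phi) (@homomorphic nat nat)) /\
     (exists phi : formula, sentence phi /\
        borel_equivalent A R (Mod phi) (@weakly_homomorphic nat nat))).
Proof.
have homS G H : homomorphic G H <-> exists h : nat -> nat, forall s x y,
    (G s x y -> H s (h x) (h y)) /\ (true -> H s (h x) (h y) -> G s x y).
  split=> -[h hh]; exists h => s x y; first by split=> [/hh|_ /hh].
  by have [h1 h2] := hh s x y; split=> // /h2; apply.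
have weakS G H : weakly_homomorphic G H <-> exists h : nat -> nat, forall s x y,
    (G s x y -> H s (h x) (h y)) /\ (false -> H s (h x) (h y) -> G s x y).
  by split=> -[h hh]; exists h => s x y; [split=> // /hh|case: (hh s x y)].
have weak_refl (G : structure nat) : weakly_homomorphic G G by exists id.
have hom_refl (G : structure nat) : homomorphic G G by exists id.
split; last first.
  move=> d X A R /analytic_quasi_order_trees[phi [f [g [[sphi mf mg]]]]].
  move=> [fO fhom fweak gphi].
  (* Each [G] in [Mod phi] is homomorphic both ways to [f (g G)], so on [Mod phi] weak homomorphism
     implies [R] of the decoded points, which in turn gives homomorphism: both relations coincide
     there. *)
  have fg G H : Mod phi G -> Mod phi H ->
      (weakly_homomorphic G H -> R (g G) (g H)) /\ (R (g G) (g H) -> homomorphic G H).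
    move=> /gphi[AG Gf fG] /gphi[AH Hf fH]; split=> [GH|].
      apply: fweak => //; apply: (weakly_homomorphic_trans (homomorphic_weakly fG)).
      exact: weakly_homomorphic_trans GH (homomorphic_weakly Hf).
    move=> /fhom fGH; apply: (homomorphic_trans Gf).
    exact: homomorphic_trans (fGH AG AH) fH.
  split; exists phi; split=> //; split.
  - exists f; split=> // [x /fO[]//|x y Ax Ay].
    by split=> [/fhom|/homomorphic_weakly/fweak]; apply.
  - exists g; split=> // [G /gphi[]//|G H GM HM].
    have [h1 h2] := fg G H GM HM.
    by split=> [/homomorphic_weakly/h1|/h2].
  - exists f; split=> // [x /fO[]//|x y Ax Ay].
    by split=> [/fhom xy|/fweak]; [apply/homomorphic_weakly/xy|apply].
  - exists g; split=> // [G /gphi[]//|G H GM HM].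
    have [h1 h2] := fg G H GM HM.
    by split=> [/h1|/h2/homomorphic_weakly].
split; split.
- split; [exact: standard_borel_omega_structure|exact: measurable_OCT| |].
    by split=> // x y z _ _ _; exact: homomorphic_trans.
  exact: analytic_OCT homS.
- move=> d X A R /analytic_quasi_order_trees[phi [f [g [[_ mf _]]]]].
  move=> [fO fhom fweak _]; exists f; split=> // [x /fO[]//|x y Ax Ay].
  by split=> [/fhom|/homomorphic_weakly/fweak]; apply.
- split; [exact: standard_borel_omega_structure|exact: measurable_OCT| |].
    by split=> // x y z _ _ _; exact: weakly_homomorphic_trans.
  exact: analytic_OCT weakS.
- move=> d X A R /analytic_quasi_order_trees[phi [f [g [[_ mf _]]]]].
  move=> [fO fhom fweak _]; exists f; split=> // [x /fO[]//|x y Ax Ay].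
  by split=> [/fhom xy|/fweak]; [apply/homomorphic_weakly/xy|apply].
Qed.
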